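(* The positive quasi-Markov category $\mathsf{Partial}(\mathsf{BorelStoch})$ is $\sigma$-continuous.
   Context: $\mathsf{Partial}(\mathsf{BorelStoch})$ has standard Borel spaces as objects. A morphism $f:X\to Y$ is a partial Markov kernel: a measurable set $D_f\subseteq X$ (its domain) together with a Markov kernel $f(\cdot|x)$, $x\in D_f$, from $D_f$ to $Y$. The composite of $f:X\to Y$ and $g:Y\to Z$ has domain $D_{gf}=\{x\in D_f\mid f(D_g|x)=1\}$ and on it $(gf)(S|x)=\int_{D_g}g(S|y)\,f(dy|x)$. The tensor product of objects is the cartesian product with product $\sigma$-algebra; $f\otimes g$ for $f:A\to X$, $g:B\to Y$ has domain $D_f\times D_g$ and is given there by product measures. Copy and delete are $\mathrm{copy}_X(\cdot|x)=\delta_{(x,x)}$ and the unique total kernel $\mathrm{del}_X:X\to I=\{\ast\}$. This is a positive quasi-Markov category. In a quasi-Markov category (a symmetric monoidal category with compatible commutative comonoid structures $\mathrm{copy}_X,\mathrm{del}_X$ on every object such that every $f:A\to X$ satisfies $f=(f\otimes \mathrm{del}_Xf)\,\mathrm{copy}_A$), the domain of $f:A\to X$ is $\mathrm{dom}(f)=(\mathrm{id}_A\otimes\mathrm{del}_Xf)\,\mathrm{copy}_A:A\to A$, and for $f,g:A\to X$ one writes $f\sqsupseteq g$ if $f\,\mathrm{dom}(g)=g$; this is a partial order on each hom-set. In $\mathsf{Partial}(\mathsf{BorelStoch})$, $f\sqsupseteq g$ means $D_f\supseteq D_g$ and $f(\cdot|a)=g(\cdot|a)$ for all $a\in D_g$.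 The category is positive if $(\mathrm{id}_Y\otimes g)\,\mathrm{copy}_Y f=(f\otimes gf)\,\mathrm{copy}_X$ whenever $f:X\to Y$, $g:Y\to Z$ and $gf$ is copyable, i.e. $\mathrm{copy}_Z\,gf=(gf\otimes gf)\,\mathrm{copy}_X$. A positive quasi-Markov category with the order $\sqsupseteq$ is $\sigma$-continuous if: (i) for every descending sequence $f_1\sqsupseteq f_2\sqsupseteq\cdots$ of morphisms $X\to Y$, the meet (greatest lower bound) $\bigwedge_{n}f_n$ exists in the hom-set; (ii) this meet is preserved by sequential and parallel composition: $h\bigl(\bigwedge_n f_n\bigr)=\bigwedge_n hf_n$, $\bigl(\bigwedge_n f_n\bigr)k=\bigwedge_n f_nk$, $\bigl(\bigwedge_nf_n\bigr)\otimes g=\bigwedge_n(f_n\otimes g)$ and $g\otimes\bigl(\bigwedge_nf_n\bigr)=\bigwedge_n(g\otimes f_n)$ for all morphisms $h,k,g$ (with $h,k$ composable as indicated). *)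

(* Defs.v *)
From HB Require Import structures.
From mathcomp Require Import all_boot all_order all_algebra.
From mathcomp Require Import all_classical all_reals all_analysis.
From mathcomp Require Import measurable_realfun giry.

Set Implicit Arguments.
Unset Strict Implicit.
Unset Printing Implicit Defensive.

Import Order.TTheory GRing.Theory Num.Theory.

Local Open Scope classical_set_scope.

(** The laws are not fields: they are the predicate [quasi_markov] below. *)
Record catData := CatData {
  obj : Type ;
  hom : obj -> obj -> Type ;
  idm : forall X, hom X X ;
  comp : forall X Y Z, hom Y Z -> hom X Y -> hom X Z ;
  unit_obj : obj ;
  tens_obj : obj -> obj -> obj ;
  tens : forall A X B Y,
    hom A X -> hom B Y -> hom (tens_obj A B) (tens_obj X Y) ;
  assoc : forall X Y Z,
    hom (tens_obj (tens_obj X Y) Z) (tens_obj X (tens_obj Y Z)) ;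
  assocV : forall X Y Z,
    hom (tens_obj X (tens_obj Y Z)) (tens_obj (tens_obj X Y) Z) ;
  lunit : forall X, hom (tens_obj unit_obj X) X ;
  lunitV : forall X, hom X (tens_obj unit_obj X) ;
  runit : forall X, hom (tens_obj X unit_obj) X ;
  runitV : forall X, hom X (tens_obj X unit_obj) ;
  swap : forall X Y, hom (tens_obj X Y) (tens_obj Y X) ;
  copy : forall X, hom X (tens_obj X X) ;
  del : forall X, hom X unit_obj
}.

Arguments idm {c} X.
Arguments comp {c X Y Z} g f : rename.
Arguments unit_obj {c}.
Arguments tens_obj {c} X Y : rename.
Arguments tens {c A X B Y} f g : rename.
Arguments assoc {c} X Y Z.
Arguments assocV {c} X Y Z.
Arguments lunit {c} X.
Arguments lunitV {c} X.
Arguments runit {c} X.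
Arguments runitV {c} X.
Arguments swap {c} X Y.
Arguments copy {c} X.
Arguments del {c} X.

Declare Scope qm_scope.
Delimit Scope qm_scope with qm.
Notation "g ∘ f" := (comp g f) (at level 40, left associativity) : qm_scope.
Notation "f ⊗ g" := (tens f g) (at level 38, left associativity) : qm_scope.
Notation "X ⊠ Y" := (tens_obj X Y) (at level 38, left associativity) : qm_scope.
Local Open Scope qm_scope.

Record is_category (C : catData) : Prop := IsCategory {
  comp_idl : forall (X Y : obj C) (f : hom X Y), idm Y ∘ f = f ;
  comp_idr : forall (X Y : obj C) (f : hom X Y), f ∘ idm X = f ;
  compA : forall (X Y Z W : obj C) (h : hom Z W) (g : hom Y Z) (f : hom X Y),
    h ∘ (g ∘ f) = (h ∘ g) ∘ f
}.

Record is_symmetric_monoidal (C : catData) : Prop := IsSymmetricMonoidal {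
  tens_id : forall X Y : obj C, idm X ⊗ idm Y = idm (X ⊠ Y) ;
  tens_comp : forall (X Y Z X' Y' Z' : obj C)
    (g : hom Y Z) (f : hom X Y) (g' : hom Y' Z') (f' : hom X' Y'),
    (g ∘ f) ⊗ (g' ∘ f') = (g ⊗ g') ∘ (f ⊗ f') ;
  assocK : forall X Y Z : obj C, assocV X Y Z ∘ assoc X Y Z = idm _ ;
  assocVK : forall X Y Z : obj C, assoc X Y Z ∘ assocV X Y Z = idm _ ;
  lunitK : forall X : obj C, lunitV X ∘ lunit X = idm _ ;
  lunitVK : forall X : obj C, lunit X ∘ lunitV X = idm _ ;
  runitK : forall X : obj C, runitV X ∘ runit X = idm _ ;
  runitVK : forall X : obj C, runit X ∘ runitV X = idm _ ;
  swapK : forall X Y : obj C, swap Y X ∘ swap X Y = idm _ ;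
  assoc_nat : forall (X Y Z X' Y' Z' : obj C)
    (f : hom X X') (g : hom Y Y') (h : hom Z Z'),
    assoc X' Y' Z' ∘ ((f ⊗ g) ⊗ h) = (f ⊗ (g ⊗ h)) ∘ assoc X Y Z ;
  lunit_nat : forall (X Y : obj C) (f : hom X Y),
    lunit Y ∘ (idm unit_obj ⊗ f) = f ∘ lunit X ;
  runit_nat : forall (X Y : obj C) (f : hom X Y),
    runit Y ∘ (f ⊗ idm unit_obj) = f ∘ runit X ;
  swap_nat : forall (X Y X' Y' : obj C) (f : hom X X') (g : hom Y Y'),
    swap X' Y' ∘ (f ⊗ g) = (g ⊗ f) ∘ swap X Y ;
  pentagon : forall X Y Z W : obj C,
    assoc X Y (Z ⊠ W) ∘ assoc (X ⊠ Y) Z W =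
    (idm X ⊗ assoc Y Z W) ∘ assoc X (Y ⊠ Z) W ∘ (assoc X Y Z ⊗ idm W) ;
  triangle : forall X Y : obj C,
    (idm X ⊗ lunit Y) ∘ assoc X unit_obj Y = runit X ⊗ idm Y ;
  hexagon : forall X Y Z : obj C,
    assoc Y Z X ∘ swap X (Y ⊠ Z) ∘ assoc X Y Z =
    (idm Y ⊗ swap X Z) ∘ assoc Y X Z ∘ (swap X Y ⊗ idm Z)
}.

Definition middle_swap (C : catData) (X Y : obj C) :
    hom ((X ⊠ X) ⊠ (Y ⊠ Y)) ((X ⊠ Y) ⊠ (X ⊠ Y)) :=
  assocV X Y (X ⊠ Y)
  ∘ (idm X ⊗ (assoc Y X Y ∘ (swap X Y ⊗ idm Y) ∘ assocV X Y Y))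
  ∘ assoc X X (Y ⊠ Y).

Record has_comonoids (C : catData) : Prop := HasComonoids {
  copyA : forall X : obj C,
    assoc X X X ∘ (copy X ⊗ idm X) ∘ copy X = (idm X ⊗ copy X) ∘ copy X ;
  copy_dell : forall X : obj C, lunit X ∘ (del X ⊗ idm X) ∘ copy X = idm X ;
  copy_delr : forall X : obj C, runit X ∘ (idm X ⊗ del X) ∘ copy X = idm X ;
  copyC : forall X : obj C, swap X X ∘ copy X = copy X ;
  copy_tens : forall X Y : obj C,
    copy (X ⊠ Y) = middle_swap X Y ∘ (copy X ⊗ copy Y) ;
  del_tens : forall X Y : obj C,
    del (X ⊠ Y) = lunit unit_obj ∘ (del X ⊗ del Y) ;
  copy_unit : copy unit_obj = lunitV (unit_obj : obj C) ;
  del_unit : del unit_obj = idm (unit_obj : obj C)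
}.

(** The right unitor [X ⊠ unit_obj -> X], usually left implicit in this equation
    and in [dom], is made explicit. *)
Definition quasi_markov_law (C : catData) : Prop :=
  forall (A X : obj C) (f : hom A X),
    f = runit X ∘ (f ⊗ (del X ∘ f)) ∘ copy A.

Definition quasi_markov (C : catData) : Prop :=
  [/\ is_category C, is_symmetric_monoidal C, has_comonoids C
    & quasi_markov_law C].

Section quasi_markov_notions.
Variable C : catData.

Definition dom (A X : obj C) (f : hom A X) : hom A A :=
  runit A ∘ (idm A ⊗ (del X ∘ f)) ∘ copy A.

(** [extends f g] is the order [f ⊒ g]. *)
Definition extends (A X : obj C) (f g : hom A X) : Prop := f ∘ dom g = g.

Definition copyable (A X : obj C) (f : hom A X) : Prop :=
  copy X ∘ f = (f ⊗ f) ∘ copy A.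

Definition positive : Prop :=
  forall (X Y Z : obj C) (f : hom X Y) (g : hom Y Z), copyable (g ∘ f) ->
    (idm Y ⊗ g) ∘ copy Y ∘ f = (f ⊗ (g ∘ f)) ∘ copy X.

Definition descending (X Y : obj C) (f : nat -> hom X Y) : Prop :=
  forall n, extends (f n) (f n.+1).

Definition is_meet (X Y : obj C) (f : nat -> hom X Y) (m : hom X Y) : Prop :=
  (forall n, extends (f n) m) /\
  (forall g, (forall n, extends (f n) g) -> extends m g).

Definition has_descending_meets : Prop :=
  forall (X Y : obj C) (f : nat -> hom X Y), descending f ->
    exists m, is_meet f m.

Definition preserves_descending_meets : Prop :=
  forall (X Y : obj C) (f : nat -> hom X Y) (m : hom X Y),
    descending f -> is_meet f m ->
    [/\ forall (Z : obj C) (h : hom Y Z), is_meet (fun n => h ∘ f n) (h ∘ m),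
        forall (W : obj C) (k : hom W X), is_meet (fun n => f n ∘ k) (m ∘ k),
        forall (A B : obj C) (g : hom A B), is_meet (fun n => f n ⊗ g) (m ⊗ g)
      & forall (A B : obj C) (g : hom A B), is_meet (fun n => g ⊗ f n) (g ⊗ m)].

Definition sigma_continuous : Prop :=
  has_descending_meets /\ preserves_descending_meets.

End quasi_markov_notions.

Local Close Scope qm_scope.
Local Open Scope ring_scope.

Section standard_borel.
Variable R : realType.

Definition polish (M : metricType R) : Prop :=
  (forall F : set_system M, ProperFilter F -> cauchy F ->
    exists x : M, F --> x) /\
  (exists2 D : set M, countable D & dense D).

Definition standard_borel d (T : measurableType d) : Prop :=
  exists (M : metricType R) (phi : T -> M),
    [/\ polish M, bijective phi
      & forall B : set M, <<s open >> B <-> measurable (phi @^-1` B)].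

End standard_borel.

Section standard_borel_closure.
Variable R : realType.

Section prod_metric.
Variables M N : metricType R.

Let pdist (x y : M * N) : R := Num.max (mdist x.1 y.1) (mdist x.2 y.2).

Let pdist_ge0 x y : 0 <= pdist x y.
Proof. by rewrite /pdist le_max mdist_ge0. Qed.

Let pdist_pos x y : pdist x y = 0 -> x = y.
Proof.
move=> xy; case: x y xy => [a b] [c d]; rewrite /pdist/= => xy.
have [ac bd] : mdist a c <= 0 /\ mdist b d <= 0.
  by split; rewrite -xy le_max lexx ?orbT.
congr pair; apply: mdist_positivity; apply/eqP; by rewrite eq_le mdist_ge0 andbT.
Qed.

Let ball_pdist x d : ball x d = [set y | pdist x y < d].
Proof.
apply/seteqP; split => y; rewrite /= /pdist gt_max.
  by move=> [] /=; rewrite !ballEmdist /= => -> ->.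
by move=> /andP[? ?]; split => /=; rewrite ballEmdist.
Qed.

HB.instance Definition _ := @PseudoMetric_isMetric.Build R (M * N)%type
  pdist pdist_ge0 pdist_pos ball_pdist.

End prod_metric.

Lemma polish_prod (M N : metricType R) :
  polish M -> polish N -> polish (M * N)%type.
Proof.
move=> [cM [D cD dD]] [cN [E cE dE]]; split.
- move=> F FF /cauchy_ballP Fc.
  have Fc1 : cauchy (fst @ F).
    apply/cauchy_ballP => e e0; rewrite !near_simpl.
    by apply: filterS (Fc e e0) => -[x y] [].
  have Fc2 : cauchy (snd @ F).
    apply/cauchy_ballP => e e0; rewrite !near_simpl.
    by apply: filterS (Fc e e0) => -[x y] [].
  have [x Fx] := cM _ _ Fc1; have [y Fy] := cN _ _ Fc2.
  exists (x, y).
  move=> A /(cvg_pair Fx Fy); rewrite !nbhs_simpl /=.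
  by apply: filterS => -[].
- exists (D `*` E); first exact: countableX.
  move=> O [[x y] Oxy] oO.
  have /nbhs_ballP[e /= e0 eO] : nbhs (x, y) O by apply: open_nbhs_nbhs; split.
  have [||a [xa Da]] := dD (ball x e)°.
  - by exists x; apply: nbhsx_ballx.
  - exact: open_interior.
  have [||b [yb Eb]] := dE (ball y e)°.
  - by exists y; apply: nbhsx_ballx.
  - exact: open_interior.
  exists (a, b); split => //.
  by apply: eO; split => /=; exact: interior_subset.
Qed.

Lemma dense_enum (M : metricType R) (D : set M) (x0 : M) :
  countable D -> dense D ->
  exists s : nat -> M, forall x e, 0 < e -> exists n, ball x e (s n).
Proof.
move=> cD dD.
have near_D x e : 0 < e -> exists2 a, D a & ball x e a.
  move=> e0; have [||a [xa Da]] := dD (ball x e)°.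
  - by exists x; apply: nbhsx_ballx.
  - exact: open_interior.
  by exists a => //; exact: interior_subset.
case/pfcard_geP: cD => [D0|[s]].
  by have [a] := near_D x0 1 ltr01; rewrite D0.
exists s => x e e0; have [a Da xa] := near_D x e e0.
by have [n _ sn] := @surj _ _ _ _ s a Da; exists n; rewrite sn.
Qed.

Lemma borel_preimage (U V : topologicalType) (f : U -> V) (B : set V) :
  continuous f -> <<s open >> B -> <<s open >> (f @^-1` B).
Proof.
move=> cf; pose G := [set B : set V | <<s open >> (f @^-1` B)].
have sG := @smallest_sigma_algebra U setT open.
suff : <<s open >> `<=` G by apply.
apply: smallest_sub.
  split; rewrite /G /=.
  + by rewrite preimage_set0; exact: sigma_algebra0.
  + by move=> C mC; rewrite setTD preimage_setC -setTD; case: sG => _ + _; apply.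
  + by move=> F mF; rewrite preimage_bigcup; exact: sigma_algebra_bigcup.
by move=> O oO; apply: sub_sigma_algebra; apply: open_comp.
Qed.

Lemma standard_borel_prod d1 d2 (T1 : measurableType d1)
    (T2 : measurableType d2) :
  standard_borel R T1 -> standard_borel R T2 ->
  standard_borel R (T1 * T2)%type.
Proof.
move=> [M [phi [pM [phi' phiK phiK'] bM]]] [N [psi [pN [psi' psiK psiK'] bN]]].
exists (M * N)%type, (fun z => (phi z.1, psi z.2)); split.
- exact: polish_prod.
- exists (fun z => (phi' z.1, psi' z.2)) => -[x y] /=.
    by rewrite phiK psiK.
  by rewrite phiK' psiK'.
have mphi (B : set M) : open B -> measurable (phi @^-1` B).
  by move=> oB; apply/bM; exact: sub_sigma_algebra.
have mpsi (B : set N) : open B -> measurable (psi @^-1` B).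
  by move=> oB; apply/bN; exact: sub_sigma_algebra.
move=> B; split.
- pose G := [set B : set (M * N) |
    measurable ((fun z : T1 * T2 => (phi z.1, psi z.2)) @^-1` B)].
  suff : <<s open >> `<=` G by apply.
  apply: smallest_sub.
    split; rewrite /G /=.
    + by rewrite preimage_set0.
    + by move=> A mA; rewrite setTD preimage_setC; exact: measurableC.
    + by move=> F mF; rewrite preimage_bigcup; exact: bigcupT_measurable.
  move=> O oO; rewrite /G /=.
  have [D cD dD] := pM.2; have [E cE dE] := pN.2.
  have [s sD] := dense_enum (phi point) cD dD.
  have [t tE] := dense_enum (psi point) cE dE.
  pose U (i : nat * nat * nat) : set (M * N) :=
    (ball (s i.1.1) i.2.+1%:R^-1)° `*` (ball (t i.1.2) i.2.+1%:R^-1)°.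
  have -> : O = \bigcup_i (if `[< U i `<=` O >] then U i else set0).
    apply/seteqP; split => [[x y] Oxy|z [i _]]; last first.
      by case: asboolP => // UO /UO.
    have /nbhs_ballP[e /= e0 eO] : nbhs (x, y) O.
      by apply: open_nbhs_nbhs; split.
    have [k ke] : exists k : nat, k.+1%:R^-1 + k.+1%:R^-1 < e :> R.
      have e20 : 0 < e / 2 by rewrite divr_gt0.
      have [k /= ke] := ltr_add_invr e20; exists k.
      by rewrite [ltRHS]splitr ltrD// -[ltLHS]add0r.
    pose r : R := k.+1%:R^-1.
    have r0 : 0 < r by rewrite invr_gt0.
    have r20 : 0 < r / 2 by rewrite divr_gt0.
    have r2r : r / 2 < r by rewrite ltr_pdivrMr// ltr_pMr// ltr1n.
    have intb (P : metricType R) (p q : P) : ball p (r / 2) q ->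
        (ball q r)° p.
      move=> pq; apply/nbhs_ballP; exists (r / 2) => //= w pw.
      by rewrite [r]splitr; apply: ball_triangle pw; exact: ball_sym.
    have [i xi] := sD x _ r20; have [j yj] := tE y _ r20.
    exists (i, j, k) => //.
    have UO : U (i, j, k) `<=` O.
      move=> -[u v] [/= /interior_subset siu /interior_subset tjv].
      apply: eO; split => /=.
      + apply: (le_ball (ltW ke)); apply: ball_triangle siu.
        exact: le_ball (ltW r2r) _ xi.
      + apply: (le_ball (ltW ke)); apply: ball_triangle tjv.
        exact: le_ball (ltW r2r) _ yj.
    by case: asboolP => // _; split; exact: intb.
  rewrite preimage_bigcup; apply: countable_bigcupT_measurable => // i.
  case: asboolP => _; last by rewrite preimage_set0.
  rewrite (_ : _ @^-1` _ = (phi @^-1` (ball (s i.1.1) i.2.+1%:R^-1)°) `*`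
    (psi @^-1` (ball (t i.1.2) i.2.+1%:R^-1)°))//.
  by apply: measurableX; [apply: mphi|apply: mpsi]; exact: open_interior.
- pose f (w : M * N) := (phi' w.1, psi' w.2).
  pose G := [set A : set (T1 * T2) | <<s open >> (f @^-1` A)].
  pose A := (fun z : T1 * T2 => (phi z.1, psi z.2)) @^-1` B.
  have BA : B = f @^-1` A.
    by apply/seteqP; split => -[x y]; rewrite /f/A/= phiK' psiK'.
  rewrite -/A [in X in _ -> X]BA; move: A {BA} => A.
  rewrite measurable_prod_measurableType.
  suff : <<s [set A `*` B | A in measurable & B in measurable] >> `<=` G.
    by apply.
  have sG := @smallest_sigma_algebra (M * N) setT open.
  apply: smallest_sub.
    split; rewrite /G /=.
    + by rewrite preimage_set0; exact: sigma_algebra0.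
    + by move=> C mC; rewrite setTD preimage_setC -setTD; case: sG => _ + _; apply.
    + by move=> F mF; rewrite preimage_bigcup; exact: sigma_algebra_bigcup.
  move=> _ [C mC [D mD <-]]; rewrite /G /=.
  have -> : f @^-1` (C `*` D) =
      (fst @^-1` (phi' @^-1` C)) `&` (snd @^-1` (psi' @^-1` D)) by [].
  have /sigma_algebraP[//|_ _ _ sGI] := sG.
  apply: sGI.
  + apply: borel_preimage; first by move=> ?; exact: cvg_fst.
    by apply/bM; rewrite -comp_preimage (_ : _ \o _ = id)//; apply/funext.
  + apply: borel_preimage; first by move=> ?; exact: cvg_snd.
    by apply/bN; rewrite -comp_preimage (_ : _ \o _ = id)//; apply/funext.
Qed.

(** An alias, so that [unit] itself receives no topology. *)
Definition point_space : Type := unit.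
HB.instance Definition _ := Choice.on point_space.

Let udist (x y : point_space) : R := 0.

Let udistxx x : udist x x = 0. Proof. by []. Qed.

Let udist_pos x y : udist x y = 0 -> x = y. Proof. by case: x; case: y. Qed.

Let udist_sym x y : udist x y = udist y x. Proof. by []. Qed.

Let udist_triangle y x z : udist x z <= udist x y + udist y z.
Proof. by rewrite /udist addr0. Qed.

HB.instance Definition _ := @isMetric.Build R point_space
  udist udistxx udist_pos udist_sym udist_triangle.

Lemma standard_borel_unit : standard_borel R unit.
Proof.
exists point_space, (fun x => x : point_space); split.
- split=> [F FF _|].
    exists (tt : point_space) => A /nbhs_singleton At.
    by rewrite (_ : A = setT) ?nbhs_simpl; [exact: filterT|apply/seteqP; split => // -[]].
  exists setT; first exact: (@countableP unit).
  by move=> O [x Ox] _; exists x.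
- by exists (fun x => x : unit).
- move=> B; split => // _; apply: sub_sigma_algebra; rewrite openE => x Bx.
  rewrite (_ : B = setT); first exact: filterT.
  by apply/seteqP; split => // y _; case: x Bx; case: y.
Qed.

End standard_borel_closure.

Local Open Scope ereal_scope.

(** A library measure is a function on all subsets of [T] whose values outside
    the sigma-algebra are arbitrary. Fixing these values to be [0] makes Leibniz
    equality of [prob] the equality of probability measures. *)
Record prob d (T : measurableType d) (R : realType) := Prob {
  prob_val :> probability T R ;
  prob_out : forall S, ~ measurable S -> prob_val S = 0
}.

Section trim.
Context d (T : measurableType d) (R : realType) (P : probability T R).

Definition trim (S : set T) : \bar R := if `[< measurable S >] then P S else 0.

Lemma trimE S : measurable S -> trim S = P S.
Proof. by rewrite /trim; case: asboolP. Qed.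

Let trim0 : trim set0 = 0. Proof. by rewrite trimE// measure0. Qed.

Let trim_ge0 S : 0 <= trim S.
Proof. by rewrite /trim; case: asboolP => // _; exact: measure_ge0. Qed.

Let trim_sigma_additive : semi_sigma_additive trim.
Proof.
move=> F mF tF mUF; rewrite trimE//.
under eq_fun do under eq_bigr do rewrite trimE//.
exact: measure_semi_sigma_additive.
Qed.

HB.instance Definition _ := isMeasure.Build _ _ _ trim
  trim0 trim_ge0 trim_sigma_additive.

Let trim_setT : trim setT = 1. Proof. by rewrite trimE// probability_setT. Qed.

HB.instance Definition _ := Measure_isProbability.Build _ _ _ trim trim_setT.

Definition prob_of : prob T R.
Proof.
by apply: (@Prob _ _ _ trim) => S nS; rewrite /= /trim; case: asboolP.
Defined.

End trim.

Section partial_map.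
Context d1 d2 (X : measurableType d1) (Y : measurableType d2) (R : realType).
Variable f : X -> option (prob Y R).

Definition pdom : set X := [set x | f x].

(** [peval x S] is [f(S|x)] for [x] in the domain. *)
Definition peval (x : X) (S : set Y) : \bar R :=
  if f x is Some p then p S else 0.

End partial_map.

Record pkernel d1 d2 (X : measurableType d1) (Y : measurableType d2)
    (R : realType) := PKernel {
  pk :> X -> option (prob Y R) ;
  measurable_pdom : measurable (pdom pk) ;
  measurable_peval : forall S : set Y, measurable S ->
    measurable_fun (pdom pk) (fun x => peval pk x S)
}.

Lemma prob_ext d (T : measurableType d) (R : realType) (p q : prob T R) :
  (forall S, measurable S -> p S = q S) -> p = q.
Proof.
move=> pq; case: p pq => p po; case: q => q qo /= pq.
have : p = q :> (set T -> \bar R).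
  apply/funext => S; have [mS|mS] := pselect (measurable S); first exact: pq.
  by rewrite po// qo.
case: p po {pq} => p [[p0 pge0] [psa] [psf] [psgf] [pfin] [psub] [p1]] /= po.
case: q qo => q [[q0 qge0] [qsa] [qsf] [qsgf] [qfin] [qsub] [q1]] /= qo pq.
subst q.
rewrite (Prop_irrelevance q0 p0) (Prop_irrelevance qge0 pge0) in qsa qo *.
rewrite (Prop_irrelevance qsa psa) (Prop_irrelevance qsf psf)
  (Prop_irrelevance qsgf psgf) (Prop_irrelevance qfin pfin)
  (Prop_irrelevance qsub psub) (Prop_irrelevance q1 p1) in qo *.
by congr Prob; exact: Prop_irrelevance.
Qed.

Lemma prob_ofE d (T : measurableType d) (R : realType) (P : probability T R) S :
  measurable S -> prob_of P S = P S.
Proof. exact: trimE. Qed.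

Section peval_lemmas.
Context d1 d2 (X : measurableType d1) (Y : measurableType d2) (R : realType).

Lemma peval_out (f : X -> option (prob Y R)) x S : ~ pdom f x -> peval f x S = 0.
Proof. by rewrite /pdom /peval /=; case: (f x). Qed.

Lemma peval_ge0 (f : X -> option (prob Y R)) x S : 0 <= peval f x S.
Proof. by rewrite /peval; case: (f x). Qed.

Lemma measurable_pevalT (f : pkernel X Y R) S : measurable S ->
  measurable_fun setT (fun x => peval f x S).
Proof.
move=> mS; have mD := measurable_pdom f.
have -> : (fun x => peval f x S) = (fun x => peval f x S) \_ (pdom f).
  apply/funext => x; rewrite patchE; case: ifPn => // /negP xD.
  by rewrite peval_out// => Dx; apply: xD; rewrite inE.
exact/(measurable_restrictT _ mD).1/measurable_peval.
Qed.

Definition pgiry (f : X -> option (prob Y R)) (x : X) : giry Y R :=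
  if f x is Some p then p else mzero.

Lemma pgiryE f x S : pgiry f x S = peval f x S.
Proof. by rewrite /pgiry /peval; case: (f x). Qed.

Lemma measurable_pgiry (f : pkernel X Y R) : measurable_fun setT (pgiry f).
Proof.
apply: measurable_giry_codensity => // B mB.
under eq_fun do rewrite pgiryE.
exact: measurable_pevalT.
Qed.

End peval_lemmas.

Section pkernel_det.
Context d1 d2 (X : measurableType d1) (Y : measurableType d2) (R : realType).
Variables (h : X -> Y) (mh : measurable_fun setT h).

Let det_fun (x : X) : option (prob Y R) := Some (prob_of (dirac (h x))).

Let det_dom : pdom det_fun = setT. Proof. exact/seteqP. Qed.

Let measurable_det_dom : measurable (pdom det_fun).
Proof. by rewrite det_dom. Qed.

Let measurable_det S : measurable S ->
  measurable_fun (pdom det_fun) (fun x => peval det_fun x S).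
Proof.
move=> mS; rewrite det_dom /peval /=.
under eq_fun do rewrite trimE//.
apply: (@measurableT_comp _ _ _ _ _ _ (fun y => dirac y S) _ h) => //.
exact: measurable_fun_dirac.
Qed.

Definition det : pkernel X Y R := PKernel measurable_det_dom measurable_det.

End pkernel_det.

Section pkernel_comp.
Context d1 d2 d3 (X : measurableType d1) (Y : measurableType d2)
  (Z : measurableType d3) (R : realType).
Variables (g : pkernel Y Z R) (f : pkernel X Y R).

Section pbind.
Variables (p : prob Y R) (p1 : p (pdom g) = 1).

Definition pbind (S : set Z) : \bar R := \int[p]_(y in pdom g) peval g y S.

Let pbind0 : pbind set0 = 0.
Proof.
rewrite /pbind; apply: integral0_eq => y _.
by rewrite /peval; case: (pk g y) => // q; exact: measure0.
Qed.

Let pbind_ge0 S : 0 <= pbind S.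
Proof. by apply: integral_ge0 => y _; exact: peval_ge0. Qed.

Let pbind_sigma_additive : semi_sigma_additive pbind.
Proof.
move=> F mF tF mUF; rewrite /pbind.
have mD := measurable_pdom g.
rewrite (_ : (fun n => _) =
  (fun n => \int[p]_(y in pdom g) \sum_(0 <= i < n) peval g y (F i))); last first.
  apply/funext => n; rewrite ge0_integral_sum//.
  - by move=> i; exact: measurable_peval.
  - by move=> i y _; exact: peval_ge0.
rewrite (_ : \int[p]_(y in pdom g) peval g y (\bigcup_n F n) =
  \int[p]_(y in pdom g) limn (fun n => \sum_(0 <= i < n) peval g y (F i))).
  apply: cvg_monotone_convergence => //.
  - move=> n; apply: emeasurable_sum => i; exact: measurable_peval.
  - by move=> n y _; apply: sume_ge0 => i _; exact: peval_ge0.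
  - move=> y _ m n mn; apply: ereal_nondecreasing_series => // i _ _.
    exact: peval_ge0.
apply: eq_integral => y _; rewrite /peval; case: (pk g y) => [q|]; last first.
  by rewrite eseries0.
by apply/esym/cvg_lim => //; exact: measure_semi_sigma_additive.
Qed.

HB.instance Definition _ := isMeasure.Build _ _ _ pbind
  pbind0 pbind_ge0 pbind_sigma_additive.

Let pbind_setT : pbind setT = 1.
Proof.
rewrite /pbind -p1 -[RHS]mul1e -integral_cst; last exact: measurable_pdom.
apply: eq_integral => y; rewrite inE /pdom /peval /=.
by case: (pk g y) => // q _; exact: probability_setT.
Qed.

HB.instance Definition _ :=
  Measure_isProbability.Build _ _ _ pbind pbind_setT.

Definition pbind_prob : prob Z R := prob_of pbind.

End pbind.

Let comp_fun (x : X) : option (prob Z R) :=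
  if pk f x is Some p then
    if pselect (p (pdom g) = 1) is left p1 then Some (pbind_prob p1) else None
  else None.

Let comp_dom : pdom comp_fun = pdom f `&` [set x | peval f x (pdom g) = 1].
Proof.
apply/seteqP; split => x; rewrite /pdom /comp_fun /peval /=.
  by case: (pk f x) => // p; case: pselect.
by move=> []; case: (pk f x) => // p _; case: pselect.
Qed.

Let measurable_comp_dom : measurable (pdom comp_fun).
Proof.
rewrite comp_dom; apply: (measurable_peval _ _ (emeasurable_set1 1)).
- exact: measurable_pdom.
- exact: measurable_pdom.
Qed.

Let comp_eval x S : measurable S -> pdom comp_fun x ->
  peval comp_fun x S = giry_int (pgiry f x) (fun y => peval g y S).
Proof.
move=> mS; rewrite /pdom /comp_fun {1}/peval /pgiry /=.
case: (pk f x) => // p; case: pselect => // p1 _.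
rewrite /pbind_prob prob_ofE//= /pbind /giry_int.
rewrite integral_mkcond; apply: eq_integral => y _.
rewrite patchE; case: ifPn => // /negP yD.
by rewrite peval_out// => Dy; apply: yD; rewrite inE.
Qed.

Let measurable_comp S : measurable S ->
  measurable_fun (pdom comp_fun) (fun x => peval comp_fun x S).
Proof.
move=> mS.
apply: (eq_measurable_fun
  (fun x => giry_int (pgiry f x) (fun y => peval g y S))).
  by move=> x; rewrite inE => Dx; rewrite comp_eval.
apply: (measurable_funS measurableT) => //.
apply: (@measurableT_comp _ _ _ _ _ _
  (fun mu : giry Y R => giry_int mu (fun y => peval g y S))).
  apply: measurable_giry_int; first exact: measurable_pevalT.
  by move=> y; exact: peval_ge0.
exact: measurable_pgiry.
Qed.

Definition pcomp : pkernel X Z R :=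
  PKernel measurable_comp_dom measurable_comp.

End pkernel_comp.

Section pkernel_tens.
Context d1 d2 d3 d4 (A : measurableType d1) (X : measurableType d2)
  (B : measurableType d3) (Y : measurableType d4) (R : realType).
Variables (f : pkernel A X R) (g : pkernel B Y R).

Let tens_fun (z : A * B) : option (prob (X * Y)%type R) :=
  match pk f z.1, pk g z.2 with
  | Some p, Some q => Some (prob_of (p \x q))
  | _, _ => None
  end.

Let tens_dom : pdom tens_fun = pdom f `*` pdom g.
Proof.
apply/seteqP; split => -[a b]; rewrite /pdom /tens_fun /=.
  by case: (pk f a) => // p; case: (pk g b).
by move=> []; case: (pk f a) => // p; case: (pk g b).
Qed.

Let measurable_tens_dom : measurable (pdom tens_fun).
Proof. by rewrite tens_dom; apply: measurableX; exact: measurable_pdom. Qed.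

Let measurable_tens S : measurable S ->
  measurable_fun (pdom tens_fun) (fun z => peval tens_fun z S).
Proof.
move=> mS.
apply: (eq_measurable_fun
  (fun z : A * B => giry_prod (pgiry f z.1, pgiry g z.2) S)).
  move=> z; rewrite inE /pdom /tens_fun /peval /pgiry /=.
  case: (pk f z.1) => // p; case: (pk g z.2) => // q _.
  by rewrite prob_ofE.
apply: (measurable_funS measurableT) => //.
apply: (@measurableT_comp _ _ _ _ _ _ (fun mu => giry_ev mu S)).
  exact: measurable_giry_ev.
apply: (@measurableT_comp _ _ _ _ _ _ (@giry_prod _ _ X Y R)).
  exact: measurable_giry_prod.
by apply: measurable_fun_pair; apply: measurableT_comp => //;
  exact: measurable_pgiry.
Qed.

Definition ptens : pkernel (A * B)%type (X * Y)%type R :=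
  PKernel measurable_tens_dom measurable_tens.

End pkernel_tens.

Section pkernel_empty.
Context d1 d2 (X : measurableType d1) (Y : measurableType d2) (R : realType).

Let empty_fun (x : X) : option (prob Y R) := None.

Let empty_dom : pdom empty_fun = set0.
Proof. by apply/seteqP; split. Qed.

Let measurable_empty_dom : measurable (pdom empty_fun).
Proof. by rewrite empty_dom. Qed.

Let measurable_empty S : measurable S ->
  measurable_fun (pdom empty_fun) (fun x => peval empty_fun x S).
Proof. by move=> _; rewrite empty_dom; exact: measurable_fun_set0. Qed.

Definition pempty : pkernel X Y R :=
  PKernel measurable_empty_dom measurable_empty.

End pkernel_empty.

Record inhabitedBorel (R : realType) := InhabitedBorel {
  ib_display : measure_display ;
  ib_sort :> measurableType ib_display ;
  ib_standard : standard_borel R ib_sort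
}.

(** Types with a [measurableType] structure are pointed, so the empty standard
    Borel space is added by hand. The only partial kernel from or to it is the
    one with empty domain: the hom-sets are singletons. *)
Inductive stdBorel (R : realType) :=
  | EmptySpace
  | Space of inhabitedBorel R.
Arguments EmptySpace {R}.

Section partial_borel_stoch.
Variable R : realType.

Local Notation sb := (stdBorel R).

Definition sb_hom (X Y : sb) : Type :=
  match X, Y with
  | Space X, Space Y => pkernel X Y R
  | _, _ => unit
  end.

Definition sb_comp (X Y Z : sb) : sb_hom Y Z -> sb_hom X Y -> sb_hom X Z :=
  match X, Y, Z with
  | Space X, Space Y, Space Z => fun g f => pcomp g f
  | Space X, EmptySpace, Space Z => fun _ _ => pempty X Z R
  | _, _, _ => fun _ _ => tt
  end.

Definition ib_unit : inhabitedBorel R := InhabitedBorel (standard_borel_unit R).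

Definition ib_prod (X Y : inhabitedBorel R) : inhabitedBorel R :=
  InhabitedBorel (standard_borel_prod (ib_standard X) (ib_standard Y)).

Definition sb_unit : sb := Space ib_unit.

Definition sb_prod (X Y : sb) : sb :=
  match X, Y with
  | Space X, Space Y => Space (ib_prod X Y)
  | _, _ => EmptySpace
  end.

Definition sb_tens (A X B Y : sb) :
    sb_hom A X -> sb_hom B Y -> sb_hom (sb_prod A B) (sb_prod X Y) :=
  match A, B, X, Y return
    sb_hom A X -> sb_hom B Y -> sb_hom (sb_prod A B) (sb_prod X Y) with
  | Space A, Space B, Space X, Space Y => fun f g => ptens f g
  | _, _, _, _ => fun _ _ => tt
  end.

Definition sb_id (X : sb) : sb_hom X X :=
  match X with
  | Space X => det R (@measurable_id _ X setT)
  | EmptySpace => tt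
  end.

Section measurable_structure_maps.
Context d1 d2 d3 (X : measurableType d1) (Y : measurableType d2)
  (Z : measurableType d3).

Lemma measurable_assoc :
  measurable_fun setT (fun w : X * Y * Z => (w.1.1, (w.1.2, w.2))).
Proof.
apply: measurable_fun_pair; first exact: measurableT_comp.
by apply: measurable_fun_pair => //; exact: measurableT_comp.
Qed.

Lemma measurable_assocV :
  measurable_fun setT (fun w : X * (Y * Z) => (w.1, w.2.1, w.2.2)).
Proof.
apply: measurable_fun_pair; last exact: measurableT_comp.
by apply: measurable_fun_pair => //; exact: measurableT_comp.
Qed.

Lemma measurable_lunitV : measurable_fun setT (fun x : X => (tt, x)).
Proof. exact: measurable_fun_pair. Qed.

Lemma measurable_runitV : measurable_fun setT (fun x : X => (x, tt)).
Proof. exact: measurable_fun_pair. Qed.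

Lemma measurable_swap : measurable_fun setT (fun w : X * Y => (w.2, w.1)).
Proof. exact: measurable_fun_pair. Qed.

Lemma measurable_copy : measurable_fun setT (fun x : X => (x, x)).
Proof. exact: measurable_fun_pair. Qed.

Lemma measurable_del : measurable_fun setT (fun _ : X => tt).
Proof. exact: measurable_cst. Qed.

End measurable_structure_maps.
Arguments measurable_assoc {d1 d2 d3} X Y Z.
Arguments measurable_assocV {d1 d2 d3} X Y Z.
Arguments measurable_lunitV {d1} X.
Arguments measurable_runitV {d1} X.
Arguments measurable_swap {d1 d2} X Y.
Arguments measurable_copy {d1} X.
Arguments measurable_del {d1} X.

Definition sb_assoc (X Y Z : sb) :
    sb_hom (sb_prod (sb_prod X Y) Z) (sb_prod X (sb_prod Y Z)) :=
  match X, Y, Z return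
    sb_hom (sb_prod (sb_prod X Y) Z) (sb_prod X (sb_prod Y Z)) with
  | Space X, Space Y, Space Z => det R (measurable_assoc X Y Z)
  | _, _, _ => tt
  end.

Definition sb_assocV (X Y Z : sb) :
    sb_hom (sb_prod X (sb_prod Y Z)) (sb_prod (sb_prod X Y) Z) :=
  match X, Y, Z return
    sb_hom (sb_prod X (sb_prod Y Z)) (sb_prod (sb_prod X Y) Z) with
  | Space X, Space Y, Space Z => det R (measurable_assocV X Y Z)
  | _, _, _ => tt
  end.

Definition sb_lunit (X : sb) : sb_hom (sb_prod sb_unit X) X :=
  match X with
  | Space X => det R (@measurable_snd _ _ unit X)
  | EmptySpace => tt
  end.

Definition sb_lunitV (X : sb) : sb_hom X (sb_prod sb_unit X) :=
  match X with
  | Space X => det R (measurable_lunitV X)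
  | EmptySpace => tt
  end.

Definition sb_runit (X : sb) : sb_hom (sb_prod X sb_unit) X :=
  match X with
  | Space X => det R (@measurable_fst _ _ X unit)
  | EmptySpace => tt
  end.

Definition sb_runitV (X : sb) : sb_hom X (sb_prod X sb_unit) :=
  match X with
  | Space X => det R (measurable_runitV X)
  | EmptySpace => tt
  end.

Definition sb_swap (X Y : sb) : sb_hom (sb_prod X Y) (sb_prod Y X) :=
  match X, Y return sb_hom (sb_prod X Y) (sb_prod Y X) with
  | Space X, Space Y => det R (measurable_swap X Y)
  | _, _ => tt
  end.

Definition sb_copy (X : sb) : sb_hom X (sb_prod X X) :=
  match X with
  | Space X => det R (measurable_copy X)
  | EmptySpace => tt
  end.

Definition sb_del (X : sb) : sb_hom X sb_unit :=
  match X with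
  | Space X => det R (measurable_del X)
  | EmptySpace => tt
  end.

Definition partialBorelStoch : catData := {|
  obj := sb ;
  hom := sb_hom ;
  idm := sb_id ;
  comp := sb_comp ;
  unit_obj := sb_unit ;
  tens_obj := sb_prod ;
  tens := sb_tens ;
  assoc := sb_assoc ;
  assocV := sb_assocV ;
  lunit := sb_lunit ;
  lunitV := sb_lunitV ;
  runit := sb_runit ;
  runitV := sb_runitV ;
  swap := sb_swap ;
  copy := sb_copy ;
  del := sb_del
|}.

End partial_borel_stoch.

(* Main.v *)
From mathcomp Require Import all_boot all_order all_algebra.
From mathcomp Require Import all_classical all_reals all_analysis.
From mathcomp Require Import measurable_realfun giry lra.
(* Required last, as [pcomp] is also the name of a function of ssrfun. *)
Require Import Defs.

Set Implicit Arguments.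
Unset Strict Implicit.
Unset Printing Implicit Defensive.

Import Order.TTheory GRing.Theory Num.Theory.
Local Open Scope classical_set_scope.
Local Open Scope ereal_scope.

(** A partial kernel [f] is handled through its action on test functions, the
    nonnegative measurable functions [phi]: [pint f phi x] is the integral of
    [phi] against [f(.|x)], and is [0] outside the domain of [f]. Two partial
    kernels with the same action are equal ([pkernel_ext]), and the action turns
    the structure of the category into a calculus of iterated integrals: a
    deterministic kernel [det h] acts by [phi \o h] ([pint_det]), a tensor
    product by an iterated integral ([pint_tens]), and a composite [g f] by
    [pint f (pint g phi)] as long as [pint f (pint g 1) = 1], and by [0]
    otherwise ([pint_comp]). So a partial kernel is a subprobability kernel of
    masses [0] and [1], and composition is that of subprobability kernels
    followed by replacing the results of mass less than [1] by [0].

    The laws of a quasi-Markov category follow. The coherence equations and the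
    comonoid laws only involve deterministic kernels, hence are equations between
    functions; naturality and functoriality of the tensor are the theorem of
    Fubini and Tonelli. What has to be controlled is the mass condition in the
    composites: since a function with values in [[0, 1]] and integral [1] against
    a subprobability measure equals [1] almost everywhere ([pint_ae1]), a triple
    composite has mass [1] at [x] only if the composite of the last two kernels
    has mass [1] almost everywhere, and the two bracketings agree ([pcompA]).

    Positivity is the fact that a copyable kernel takes only the values [0] and
    [1] ([copyable_zero_one]): if the average of [g(B|y)] over [f(dy|x)] is [0]
    or [1], then [g(B|y)] is almost everywhere constant, so it factors out of the
    integral over any set [A], and [kernel_positive] follows by comparing the two
    joint laws on rectangles.

    For continuity, [f] extends [g] exactly when [f] agrees with [g] on the
    domain of [g] ([kernel_extendsP]), so the meet of a descending sequence is
    its common restriction to the intersection of the domains ([pmeet]).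
    Postcomposition and tensoring act pointwise on the source, so they preserve
    this description of the meet ([pointwise_meet_map]). Precomposition with [k]
    does because [k(.|w)] gives mass [1] to a countable intersection as soon as
    it gives mass [1] to each of the sets ([pointwise_meet_precomp]). *)

(** * Preliminaries on extended reals, indicators and probabilities *)

Lemma mul_le1_eq1 (R : realType) (a b : \bar R) :
  0 <= a -> a <= 1 -> 0 <= b -> b <= 1 ->
  (a * b == 1) = (a == 1) && (b == 1).
Proof.
move=> a0 a1 b0 b1; apply/eqP/andP; last by move=> [/eqP-> /eqP->]; rewrite mule1.
move=> ab; split; rewrite eq_le ?a1 ?b1 -ab /=.
  by rewrite muleC gee_pMl// ge0_fin_numE// (le_lt_trans b1)// ltry.
by rewrite gee_pMl// ge0_fin_numE// (le_lt_trans a1)// ltry.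
Qed.

Lemma indic_le1 T (R : realType) (A : set T) x : (\1_A x)%:E <= 1 :> \bar R.
Proof. by rewrite indicE lee_fin; case: (_ \in _). Qed.

Lemma indic_setX T T' (R : realType) (A : set T) (B : set T') x y :
  (\1_(A `*` B) (x, y))%:E = (\1_A x)%:E * (\1_B y)%:E :> \bar R.
Proof. by rewrite !indicE in_setX/= -EFinM -natrM mulnb. Qed.

Lemma probability_bigcap d (T : measurableType d) (R : realType)
    (p : probability T R) (D : nat -> set T) :
  (forall n, measurable (D n)) -> (forall n, p (D n) = 1) ->
  p (\bigcap_n D n) = 1.
Proof.
move=> mD pD; have mI : measurable (\bigcap_n D n) by exact: bigcap_measurable.
have : p.-negligible (\bigcup_n ~` D n).
  apply: negligible_bigcup => n; apply/negligibleP; first exact: measurableC.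
  by apply: etrans (probability_setC p (mD n)) _; rewrite pD subee.
rewrite -setC_bigcap => /(negligibleP p (measurableC mI)) pC.
rewrite -[X in p X]setCK probability_setC; last exact: measurableC.
by rewrite [X in _ - X]pC sube0.
Qed.

(** * The action of partial kernels on test functions *)

Definition testfun d (T : measurableType d) (R : realType) (phi : T -> \bar R) :=
  measurable_fun setT phi /\ forall x, 0 <= phi x.

Definition pint d1 d2 (X : measurableType d1) (Y : measurableType d2)
    (R : realType) (f : X -> option (prob Y R)) (phi : Y -> \bar R) (x : X) :
    \bar R :=
  giry_int (pgiry f x) phi.

Section testfun_lemmas.
Context d (T : measurableType d) (R : realType).

Lemma testfun_cst1 : testfun (fun _ : T => 1 : \bar R).
Proof. by split. Qed.

Lemma testfun_indic (S : set T) : measurable S ->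
  testfun (fun x => (\1_S x)%:E : \bar R).
Proof.
move=> mS; split; first exact/measurable_EFinP/measurable_indic.
by move=> x; rewrite lee_fin.
Qed.

Lemma testfun_sect2 d' (T' : measurableType d') (phi : T * T' -> \bar R) x :
  testfun phi -> testfun (fun y => phi (x, y)).
Proof.
move=> [mphi phi0]; split=> //.
by apply: (measurableT_comp mphi); exact: measurable_fun_pair.
Qed.

Lemma testfun_sect1 d' (T' : measurableType d') (phi : T' * T -> \bar R) y :
  testfun phi -> testfun (fun x => phi (x, y)).
Proof.
move=> [mphi phi0]; split=> //.
by apply: (measurableT_comp mphi); exact: measurable_fun_pair.
Qed.

Lemma testfun_comp d' (T' : measurableType d') (h : T' -> T) (phi : T -> \bar R) :
  measurable_fun setT h -> testfun phi -> testfun (fun x => phi (h x)).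
Proof.
by move=> mh [mphi phi0]; split=> //; exact: (measurableT_comp mphi mh).
Qed.

End testfun_lemmas.

#[local] Hint Resolve testfun_cst1 : core.

Section pint_lemmas.
Context d1 d2 (X : measurableType d1) (Y : measurableType d2) (R : realType).
Implicit Types (f g : X -> option (prob Y R)) (phi psi : Y -> \bar R).

Lemma pint_Some f x p phi : f x = Some p -> pint f phi x = \int[p]_y phi y.
Proof. by rewrite /pint /pgiry => ->. Qed.

Lemma pint_None f x phi : f x = None -> pint f phi x = 0.
Proof. by rewrite /pint /pgiry => ->; exact: integral_measure_zero. Qed.

Lemma eq_pint f x phi psi : phi =1 psi -> pint f phi x = pint f psi x.
Proof. by move=> /funext ->. Qed.

Lemma pint_indic f x S : measurable S ->
  pint f (fun y => (\1_S y)%:E) x = peval f x S.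
Proof.
by move=> mS; rewrite /pint /giry_int integral_indic// setIT -pgiryE.
Qed.

Lemma pint1 f x : pint f (fun=> 1) x = (if f x then 1 else 0).
Proof.
case: (f x) (@pint_Some f x) (@pint_None f x) => [p|] H1 H0.
  rewrite (H1 p)// integral_cst// mul1e; exact: probability_setT.
exact: H0.
Qed.

Lemma pint_ge0 f phi x : testfun phi -> 0 <= pint f phi x.
Proof. by move=> [_ phi0]; apply: integral_ge0. Qed.

Lemma le_pint f phi psi x : testfun phi -> testfun psi ->
  (forall y, phi y <= psi y) -> pint f phi x <= pint f psi x.
Proof.
move=> [? ?] [? ?] phipsi; exact: ge0_le_integral.
Qed.

Lemma pint_le1 f phi x : testfun phi -> (forall y, phi y <= 1) ->
  pint f phi x <= 1.
Proof.
move=> tphi phi1; apply: (le_trans (le_pint f x tphi (testfun_cst1 _ _) phi1)).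
by rewrite pint1; case: ifP => _; rewrite ?lexx ?lee01.
Qed.

Lemma pintZl f phi c x : testfun phi -> 0 <= c ->
  pint f (fun y => c * phi y) x = c * pint f phi x.
Proof. by move=> [mphi phi0] c0; apply: ge0_integralZl. Qed.

Lemma pint_cst f c x : 0 <= c -> pint f (fun=> c) x = c * pint f (fun=> 1) x.
Proof.
move=> c0; rewrite -pintZl//.
by apply: eq_pint => y; rewrite mule1.
Qed.

(** Integrating out a variable is again a test function, which is what lets
    integrals be iterated. *)
Lemma testfun_pint (f : pkernel X Y R) phi : testfun phi -> testfun (pint f phi).
Proof.
move=> tphi; split; last by move=> x; exact: pint_ge0.
case: tphi => ? ?; apply: (measurableT_comp (f := giry_int ^~ phi)).
  exact: measurable_giry_int.
exact: measurable_pgiry.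
Qed.

(** [u] has mean [1] and is bounded by [1], hence equals [1] almost everywhere,
    and the integrals of [phi] and [psi] see only the points where it does. The
    useful choices of [u] are the mass of a kernel, its value on a fixed set, and
    an indicator. *)
Lemma pint_ae1 f (u : Y -> \bar R) phi psi x :
  testfun u -> (forall y, u y <= 1) -> pint f u x = 1 ->
  testfun phi -> testfun psi -> (forall y, u y = 1 -> phi y = psi y) ->
  pint f phi x = pint f psi x.
Proof.
move=> [mu u0] u1; case fx : (f x) => [p|]; last first.
  by rewrite (pint_None _ fx) => /esym/eqP; rewrite onee_eq0.
rewrite !(pint_Some _ fx) => pu1 [mphi phi0] [mpsi psi0] phipsi.
have ufin y : u y \is a fin_num.
  by rewrite ge0_fin_numE//; apply: le_lt_trans (u1 y) _; rewrite ltry.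
have m1u : measurable_fun setT (fun y => 1 - u y) by exact: emeasurable_funB.
have u1ge0 y : 0 <= 1 - u y by rewrite suber_ge0.
have pu : \int[p]_y (1 - u y) = 0.
  have : \int[p]_y (u y + (1 - u y)) = 1.
    rewrite -[RHS](@probability_setT _ _ _ p) -[RHS]mul1e -integral_cst//.
    by apply: eq_integral => y _; rewrite addeC subeK.
  rewrite ge0_integralD// pu1.
  by case: (\int[p]_y (1 - u y)) => // r; rewrite -EFinD => -[] r0; congr _%:E; lra.
have /(ae_eq_integral_abs p measurableT m1u) ae1 :
    \int[p]_y `|1 - u y| = 0.
  by rewrite -[RHS]pu; apply: eq_integral => y _; rewrite gee0_abs.
apply: ge0_ae_eq_integral => //.
apply: filterS ae1 => y /(_ I) /= uy _; apply: phipsi.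
move: uy; rewrite -(fineK (ufin y)) -EFinB => -[] /eqP.
by rewrite subr_eq0 => /eqP <-.
Qed.

End pint_lemmas.

Section pkernel_ext.
Context d1 d2 (X : measurableType d1) (Y : measurableType d2) (R : realType).

Lemma pk_inj (f g : pkernel X Y R) : pk f = pk g -> f = g.
Proof.
case: f => f mD mf; case: g => g mD' mg /= fg; subst g.
by rewrite (Prop_irrelevance mD' mD) (Prop_irrelevance mg mf).
Qed.

(** The domain is determined as well: a point is in it exactly when the whole
    space has mass [1] there. *)
Lemma peval_inj d0 (X' : measurableType d0) (f : X -> option (prob Y R))
    (g : X' -> option (prob Y R)) x x' :
  (forall S, measurable S -> peval f x S = peval g x' S) -> f x = g x'.
Proof.
rewrite /peval; case: (f x) (g x') => [p|] [q|]// pq.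
- by rewrite (prob_ext pq).
- have := pq _ measurableT; rewrite [LHS]probability_setT => /eqP.
  by rewrite onee_eq0.
- have := pq _ measurableT; rewrite [RHS]probability_setT => /esym/eqP.
  by rewrite onee_eq0.
Qed.

Lemma pint_inj d0 (X' : measurableType d0) (f : X -> option (prob Y R))
    (g : X' -> option (prob Y R)) x x' :
  (forall phi, testfun phi -> pint f phi x = pint g phi x') -> f x = g x'.
Proof.
move=> fg; apply: peval_inj => S mS; rewrite -!pint_indic//.
by apply: fg; exact: testfun_indic.
Qed.

Lemma pkernel_ext (f g : pkernel X Y R) :
  (forall phi x, testfun phi -> pint f phi x = pint g phi x) -> f = g.
Proof.
by move=> fg; apply: pk_inj; apply/funext => x; apply: pint_inj => phi ?; exact: fg.
Qed.

End pkernel_ext.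

Section pint_operations.
Context (R : realType).

Lemma pint_det d1 d2 (X : measurableType d1) (Y : measurableType d2)
    (h : X -> Y) (mh : measurable_fun setT h) (phi : Y -> \bar R) x :
  testfun phi -> pint (det R mh) phi x = phi (h x).
Proof.
move=> [mphi phi0]; rewrite /pint /giry_int /=.
rewrite (eq_measure_integral (dirac (h x))); last first.
  by move=> A mA _; exact: trimE.
by rewrite integral_dirac// diracT mul1e.
Qed.

Lemma peval_pcomp d1 d2 d3 (X : measurableType d1) (Y : measurableType d2)
    (Z : measurableType d3) (g : pkernel Y Z R) (f : pkernel X Y R) x S :
  measurable S ->
  peval (pcomp g f) x S =
  if pint f (pint g (fun=> 1)) x == 1 then pint f (fun y => peval g y S) x
  else 0.
Proof.
move=> mS.
have -> : pint f (pint g (fun=> 1)) x = peval f x (pdom g).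
  rewrite -pint_indic; last exact: measurable_pdom.
  apply: eq_pint => y; rewrite pint1 indicE /pdom.
  case: ifPn => gy; first by rewrite mem_set.
  by rewrite memNset//=; exact/negP.
rewrite {1 2}/peval /=; case fx : (pk f x) => [p|]; last first.
  by rewrite ifF// eq_sym onee_eq0.
case: pselect => /= [p1|/eqP/negPf->//]; rewrite p1 eqxx.
rewrite (pint_Some _ fx) prob_ofE//= /pbind integral_mkcond.
apply: eq_integral => y _; rewrite patchE; case: ifPn => // /negP yD.
by rewrite peval_out// => Dy; apply: yD; rewrite inE.
Qed.

(** The mass [pint f (pint g 1) x] is [f(D_g|x)], because [g] has mass [1] on its
    domain and [0] outside; on the domain of the composite the formula is the
    bind of the Giry monad. *)
Lemma pint_comp d1 d2 d3 (X : measurableType d1) (Y : measurableType d2)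
    (Z : measurableType d3) (g : pkernel Y Z R) (f : pkernel X Y R) phi x :
  testfun phi ->
  pint (pcomp g f) phi x =
  if pint f (pint g (fun=> 1)) x == 1 then pint f (pint g phi) x else 0.
Proof.
move=> [mphi phi0].
case: ifPn => M1.
  rewrite /pint -(giry_int_bind _ (measurable_pgiry g))// /giry_int.
  apply: eq_measure_integral => A mA _.
  transitivity (peval (pcomp g f) x A); first exact: pgiryE.
  rewrite peval_pcomp// M1 /giry_bind/= /pint giry_int_map//.
  - by apply: eq_integral => y _; rewrite -pgiryE.
  - exact: measurable_giry_ev.
apply: pint_None; case cx : (pk _ x) => [r|//].
have := peval_pcomp g f x measurableT; rewrite (negPf M1) /peval cx.
by rewrite [LHS]probability_setT => /eqP; rewrite onee_eq0.
Qed.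

Lemma pint_compT d1 d2 d3 (X : measurableType d1) (Y : measurableType d2)
    (Z : measurableType d3) (g : pkernel Y Z R) (f : pkernel X Y R) phi x :
  testfun phi -> pint f (pint g (fun=> 1)) x = 1 ->
  pint (pcomp g f) phi x = pint f (pint g phi) x.
Proof. by move=> tphi fg; rewrite pint_comp// fg eqxx. Qed.

Lemma pint_compF d1 d2 d3 (X : measurableType d1) (Y : measurableType d2)
    (Z : measurableType d3) (g : pkernel Y Z R) (f : pkernel X Y R) phi x :
  testfun phi -> pint f (pint g (fun=> 1)) x != 1 ->
  pint (pcomp g f) phi x = 0.
Proof. by move=> tphi fg; rewrite pint_comp// (negPf fg). Qed.

(** A total kernel imposes no mass condition: outside the domain of [f] both sides
    vanish. *)
Lemma pint_comp_detl d1 d2 d3 (X : measurableType d1) (Y : measurableType d2)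
    (Z : measurableType d3) (h : Y -> Z) (mh : measurable_fun setT h)
    (f : pkernel X Y R) phi x :
  testfun phi -> pint (pcomp (det R mh) f) phi x = pint f (fun y => phi (h y)) x.
Proof.
move=> tphi; rewrite pint_comp//.
have -> : pint (det R mh) (fun=> 1) = fun=> 1.
  by apply/funext => y; rewrite pint_det.
have -> : pint (det R mh) phi = fun y => phi (h y).
  by apply/funext => y; rewrite pint_det.
rewrite pint1; case fx : (pk f x) => /=; first by rewrite eqxx.
by rewrite eq_sym onee_eq0 (pint_None _ fx).
Qed.

Lemma pcomp_detr d1 d2 d3 (X : measurableType d1) (Y : measurableType d2)
    (Z : measurableType d3) (h : X -> Y) (mh : measurable_fun setT h)
    (g : pkernel Y Z R) x :
  pcomp g (det R mh) x = g (h x).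
Proof.
apply: pint_inj => phi tphi; rewrite pint_comp//.
have tg1 := testfun_pint g (testfun_cst1 _ _).
have tg := testfun_pint g tphi.
rewrite !pint_det// pint1; case gx : (pk g _) => /=; first by rewrite eqxx.
by rewrite eq_sym onee_eq0 (pint_None _ gx).
Qed.

Lemma pint_comp_detr d1 d2 d3 (X : measurableType d1) (Y : measurableType d2)
    (Z : measurableType d3) (h : X -> Y) (mh : measurable_fun setT h)
    (g : pkernel Y Z R) phi x :
  pint (pcomp g (det R mh)) phi x = pint g phi (h x).
Proof. by rewrite /pint /pgiry pcomp_detr. Qed.

Section tens.
Context d1 d2 d3 d4 (A : measurableType d1) (X : measurableType d2)
  (B : measurableType d3) (Y : measurableType d4).

Lemma pint_tens (f : pkernel A X R) (g : pkernel B Y R) phi a b : testfun phi ->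
  pint (ptens f g) phi (a, b) = pint f (fun x => pint g (fun y => phi (x, y)) b) a.
Proof.
move=> [mphi phi0].
case fa : (pk f a) => [p|]; last first.
  by rewrite (pint_None _ fa) (@pint_None _ _ _ _ _ (ptens f g))//= fa.
case gb : (pk g b) => [q|]; last first.
  rewrite (@pint_None _ _ _ _ _ (ptens f g))//= ?fa ?gb//.
  rewrite -[LHS](integral0 p setT) (pint_Some _ fa).
  by apply: eq_integral => x _; rewrite (pint_None _ gb).
rewrite (pint_Some _ fa) (@pint_Some _ _ _ _ _ (ptens f g) _ (prob_of (p \x q))).
  rewrite (eq_measure_integral (p \x q)); last by move=> S mS _; exact: trimE.
  rewrite fubini_tonelli1//; apply: eq_integral => x _.
  by rewrite (pint_Some _ gb).
by rewrite /= fa gb.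
Qed.

Lemma pint_swap (f : pkernel A X R) (g : pkernel B Y R) phi a b : testfun phi ->
  pint f (fun x => pint g (fun y => phi (x, y)) b) a =
  pint g (fun y => pint f (fun x => phi (x, y)) a) b.
Proof.
move=> [mphi phi0].
exact: etrans (esym (giry_int_prod1 _ _ mphi phi0)) (giry_int_prod2 _ _ mphi phi0).
Qed.

End tens.

(** Joint measurability in the point of [X] and in the point [b] where [g] is
    evaluated: the function is the action of the kernel [g (x) id] on the swapped
    test function. *)
Lemma testfun_pint_param d1 d2 d3 (X : measurableType d1) (Y : measurableType d2)
    (B : measurableType d3) (g : pkernel B Y R) phi : testfun phi ->
  testfun (fun z : X * B => pint g (fun y => phi (z.1, y)) z.2).
Proof.
move=> tphi.
pose psi (w : Y * X) := phi (w.2, w.1).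
have tpsi : testfun psi by apply: testfun_comp tphi; exact: measurable_swap.
have := testfun_comp (@measurable_swap _ _ X B)
  (testfun_pint (ptens g (det R (@measurable_id _ X setT))) tpsi).
congr testfun; apply/funext => -[x b]; rewrite pint_tens//; apply: eq_pint => y /=.
by rewrite pint_det//; exact: testfun_sect2.
Qed.

End pint_operations.

(* Otherwise [/=] exposes the measures that these kernels are built from. *)
Arguments det : simpl never.
Arguments pcomp : simpl never.
Arguments ptens : simpl never.

(** * Deterministic kernels *)

Section det.
Context (R : realType).

(** With [det_comp] and [det_tens], this reduces an equation between composites
    of structure maps to an equation between functions. *)
Lemma eq_det d1 d2 (X : measurableType d1) (Y : measurableType d2)
    (h h' : X -> Y) (mh : measurable_fun setT h) (mh' : measurable_fun setT h') :
  h =1 h' -> det R mh = det R mh'.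
Proof.
move=> hh'; apply: pkernel_ext => phi x tphi.
by rewrite !pint_det// hh'.
Qed.

Lemma det_comp d1 d2 d3 (X : measurableType d1) (Y : measurableType d2)
    (Z : measurableType d3) (h : X -> Y) (mh : measurable_fun setT h)
    (k : Y -> Z) (mk : measurable_fun setT k) :
  pcomp (det R mk) (det R mh) = det R (measurableT_comp mk mh).
Proof.
apply: pkernel_ext => phi x tphi.
by rewrite pint_comp_detr !pint_det.
Qed.

Section tens.
Context d1 d2 d3 d4 (A : measurableType d1) (X : measurableType d2)
  (B : measurableType d3) (Y : measurableType d4).

Lemma measurable_fun_prodmap (h : A -> X) (k : B -> Y) :
  measurable_fun setT h -> measurable_fun setT k ->
  measurable_fun setT (fun z : A * B => (h z.1, k z.2)).
Proof. by move=> mh mk; apply: measurable_fun_pair; exact: measurableT_comp. Qed.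

Lemma det_tens (h : A -> X) (k : B -> Y)
    (mh : measurable_fun setT h) (mk : measurable_fun setT k) :
  ptens (det R mh) (det R mk) = det R (measurable_fun_prodmap mh mk).
Proof.
apply: pkernel_ext => phi -[a b] tphi.
have tl := testfun_sect1 b (testfun_pint_param (det R mk) tphi).
have tr := testfun_sect2 (h a) tphi.
by rewrite pint_tens// pint_det// !pint_det.
Qed.

End tens.
End det.

(** * Associativity and interchange *)

Section laws.
Context (R : realType).

Section comp_laws.
Context d1 d2 d3 d4 (X : measurableType d1) (Y : measurableType d2)
  (Z : measurableType d3) (W : measurableType d4).

Lemma pcomp_idl (f : pkernel X Y R) :
  pcomp (det R (@measurable_id _ Y setT)) f = f.
Proof. by apply: pkernel_ext => phi x tphi; rewrite pint_comp_detl. Qed.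

Lemma pcomp_idr (f : pkernel X Y R) :
  pcomp f (det R (@measurable_id _ X setT)) = f.
Proof. by apply: pkernel_ext => phi x tphi; rewrite pint_comp_detr. Qed.

(** Both composites are defined at [x] exactly when the mass [pint f t x] of the
    triple composite of subprobability kernels is [1], where [t] is the mass of
    [h g] before truncation: this forces [f(D_g|x) = 1] since [t] is bounded by the mass of [g],
    and it forces [t = 1] almost everywhere, so that truncating [h g] where
    [t < 1] changes nothing. *)
Lemma pcompA (h : pkernel Z W R) (g : pkernel Y Z R) (f : pkernel X Y R) :
  pcomp h (pcomp g f) = pcomp (pcomp h g) f.
Proof.
apply: pkernel_ext => phi x tphi.
pose u := pint h (fun=> 1).
have tu : testfun u by exact: testfun_pint.
have u1 z : u z <= 1 by exact: pint_le1.
pose t := pint g u.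
have ht : testfun t by exact: testfun_pint.
have t1 y : t y <= 1 by exact: pint_le1.
have tphi' := testfun_pint h tphi.
have le_t_g y : t y <= pint g (fun=> 1) y by exact: le_pint.
have tg1 := testfun_pint g (testfun_cst1 Z R).
have hgT psi y : testfun psi -> t y = 1 ->
    pint (pcomp h g) psi y = pint g (pint h psi) y.
  by move=> tpsi ty; rewrite pint_compT.
have thg psi : testfun psi -> testfun (pint (pcomp h g) psi).
  exact: testfun_pint.
have [ft|ft] := eqVneq (pint f t x) 1.
  have fg : pint f (pint g (fun=> 1)) x = 1.
    apply/eqP; rewrite eq_le; apply/andP; split.
      by apply: pint_le1 => // y; exact: pint_le1.
    by rewrite -[leLHS]ft; exact: le_pint.
  rewrite pint_compT//; last by rewrite pint_compT.
  rewrite pint_compT//.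
  rewrite pint_compT//; last first.
    rewrite -[RHS]ft; apply: (pint_ae1 ht t1 ft); [exact: thg|exact: ht|].
    by move=> y ty; rewrite hgT.
  apply: (pint_ae1 ht t1 ft); [exact: testfun_pint|exact: thg|].
  by move=> y ty; rewrite hgT.
rewrite pint_compF//; last first.
  have [fg|fg] := eqVneq (pint f (pint g (fun=> 1)) x) 1.
    by rewrite pint_compT.
  by rewrite pint_compF// eq_sym onee_eq0.
rewrite pint_compF//; apply: contra_neq ft => ft.
apply/eqP; rewrite eq_le pint_le1//= -[leLHS]ft.
apply: le_pint; [exact: thg|exact: ht|move=> y].
have [ty|ty] := eqVneq (t y) 1; first by rewrite hgT.
by rewrite pint_compF//; exact: pint_ge0.
Qed.

End comp_laws.

Section tens_comp.
Context d1 d2 d3 d4 d5 d6 (X : measurableType d1) (Y : measurableType d2)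
  (Z : measurableType d3) (X' : measurableType d4) (Y' : measurableType d5)
  (Z' : measurableType d6).

(** The masses multiply, and a product of two numbers in [[0, 1]] is [1] only if
    both factors are, so the two sides have the same domain; on it they differ by
    exchanging the integrals over [g(.|y)] and [f'(.|b)]. *)
Lemma ptens_comp (g : pkernel Y Z R) (f : pkernel X Y R)
    (g' : pkernel Y' Z' R) (f' : pkernel X' Y' R) :
  ptens (pcomp g f) (pcomp g' f') = pcomp (ptens g g') (ptens f f').
Proof.
apply: pkernel_ext => phi -[a b] tphi.
have tg1 := testfun_pint g (testfun_cst1 Z R).
have tg1' := testfun_pint g' (testfun_cst1 Z' R).
have g_le1 y : pint g (fun=> 1) y <= 1 by exact: pint_le1.
have g'_le1 y : pint g' (fun=> 1) y <= 1 by exact: pint_le1.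
pose m := pint f (pint g (fun=> 1)) a; pose m' := pint f' (pint g' (fun=> 1)) b.
have mm' : pint (ptens f f') (pint (ptens g g') (fun=> 1)) (a, b) = m * m'.
  rewrite pint_tens; last exact: testfun_pint.
  rewrite muleC -pintZl//; last exact: pint_ge0.
  apply: eq_pint => y; rewrite muleC -pintZl//; last exact: pint_ge0.
  apply: eq_pint => y'; rewrite pint_tens//.
  by rewrite [LHS]pint_cst; [rewrite muleC|exact: pint_ge0].
have mm'1 : (m * m' == 1) = (m == 1) && (m' == 1).
  by apply: mul_le1_eq1; [exact: pint_ge0|exact: pint_le1|exact: pint_ge0|exact: pint_le1].
have tsec z := testfun_sect2 z tphi.
rewrite pint_tens//.
have tin := testfun_sect1 b (testfun_pint_param (pcomp g' f') tphi).
have [fg|fg] := eqVneq m 1; last first.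
  by rewrite pint_compF// pint_compF// mm' mm'1 (negPf fg).
rewrite pint_compT//.
have [f'g'|f'g'] := eqVneq m' 1; last first.
  rewrite [RHS]pint_compF//; last by rewrite mm' mm'1 (negPf f'g') andbF.
  have -> : (fun z => pint (pcomp g' f') (fun z' => phi (z, z')) b) = fun=> 0.
    by apply/funext => z; rewrite pint_compF.
  have -> : pint g (fun=> 0) = fun=> 0.
    by apply/funext => y; rewrite pint_cst// mul0e.
  by rewrite pint_cst// mul0e.
rewrite pint_compT//; last by rewrite mm' fg f'g' mule1.
rewrite pint_tens//; last exact: testfun_pint.
apply: eq_pint => y /=.
transitivity (pint g (fun z => pint f' (pint g' (fun z' => phi (z, z'))) b) y).
  by apply: eq_pint => z; rewrite pint_compT.
rewrite (pint_swap g f' y b (phi := fun w => pint g' (fun z' => phi (w.1, z')) w.2)).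
  by apply: eq_pint => y'; rewrite pint_tens.
exact: testfun_pint_param.
Qed.

End tens_comp.
End laws.

(** * Naturality of the structure maps *)

Section kernels.
Context (R : realType).

Section triple.
Context d1 d2 d3 d4 d5 d6 (X : measurableType d1) (X' : measurableType d2)
  (Y : measurableType d3) (Y' : measurableType d4)
  (Z : measurableType d5) (Z' : measurableType d6).

Lemma ptens_assoc_nat (f : pkernel X X' R) (g : pkernel Y Y' R) (h : pkernel Z Z' R) :
  pcomp (det R (@measurable_assoc _ _ _ X' Y' Z')) (ptens (ptens f g) h) =
  pcomp (ptens f (ptens g h)) (det R (@measurable_assoc _ _ _ X Y Z)).
Proof.
apply: pkernel_ext => phi -[[a b] c] tphi.
have tassoc := testfun_comp (@measurable_assoc _ _ _ X' Y' Z') tphi.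
rewrite pint_comp_detl// pint_comp_detr pint_tens// pint_tens; last first.
  exact: (testfun_sect1 c (testfun_pint_param h tassoc)).
rewrite pint_tens//; apply: eq_pint => x.
by rewrite pint_tens//; exact: testfun_sect2.
Qed.

End triple.

Section pair.
Context d1 d2 d3 d4 (X : measurableType d1) (X' : measurableType d2)
  (Y : measurableType d3) (Y' : measurableType d4).

Lemma ptens_swap_nat (f : pkernel X X' R) (g : pkernel Y Y' R) :
  pcomp (det R (@measurable_swap _ _ X' Y')) (ptens f g) =
  pcomp (ptens g f) (det R (@measurable_swap _ _ X Y)).
Proof.
apply: pkernel_ext => phi -[a b] tphi.
have tswap := testfun_comp (@measurable_swap _ _ X' Y') tphi.
by rewrite pint_comp_detl// pint_comp_detr !pint_tens// pint_swap.
Qed.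

Lemma ptens_lunit_nat (f : pkernel X Y R) :
  pcomp (det R (@measurable_snd _ _ unit Y))
    (ptens (det R (@measurable_id _ unit setT)) f) =
  pcomp f (det R (@measurable_snd _ _ unit X)).
Proof.
apply: pkernel_ext => phi -[u x] tphi.
have t2 := testfun_comp (@measurable_snd _ _ unit Y) tphi.
rewrite pint_comp_detl// pint_comp_detr pint_tens// pint_det//.
exact: (testfun_sect1 x (testfun_pint_param f t2)).
Qed.

Lemma ptens_runit_nat (f : pkernel X Y R) :
  pcomp (det R (@measurable_fst _ _ Y unit))
    (ptens f (det R (@measurable_id _ unit setT))) =
  pcomp f (det R (@measurable_fst _ _ X unit)).
Proof.
apply: pkernel_ext => phi -[x u] tphi.
have t2 := testfun_comp (@measurable_fst _ _ Y unit) tphi.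
rewrite pint_comp_detl// pint_comp_detr pint_tens//.
by apply: eq_pint => y; rewrite pint_det//; exact: (testfun_sect2 y t2).
Qed.

End pair.

(** * Domains, restriction and the extension order *)

Section domain.
Context d1 d2 (X : measurableType d1) (Y : measurableType d2).

Lemma pint_del (f : pkernel X Y R) phi x : testfun phi ->
  pint (pcomp (det R (@measurable_del _ Y)) f) phi x = if f x then phi tt else 0.
Proof.
move=> tphi; rewrite pint_comp_detl// pint_cst; last by case: tphi.
by rewrite pint1; case: ifP => _; rewrite ?mule1 ?mule0.
Qed.

Lemma kernel_quasi_markov (f : pkernel X Y R) :
  f = pcomp (pcomp (det R (@measurable_fst _ _ Y unit))
    (ptens f (pcomp (det R (@measurable_del _ Y)) f)))
    (det R (@measurable_copy _ X)).
Proof.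
apply: pkernel_ext => phi x tphi.
have t2 := testfun_comp (@measurable_fst _ _ Y unit) tphi.
rewrite pint_comp_detr pint_comp_detl// pint_tens//.
case fx : (pk f x) => [p|]; last by rewrite !(pint_None _ fx).
by apply: eq_pint => y; rewrite pint_del ?fx//; exact: testfun_sect2 t2.
Qed.

(** The composite that defines [dom f], written with kernels. *)
Definition pdomain (f : pkernel X Y R) : pkernel X X R :=
  pcomp (pcomp (det R (@measurable_fst _ _ X unit))
    (ptens (det R (@measurable_id _ X setT))
       (pcomp (det R (@measurable_del _ Y)) f)))
    (det R (@measurable_copy _ X)).

Lemma pint_pdomain (f : pkernel X Y R) phi x : testfun phi ->
  pint (pdomain f) phi x = if f x then phi x else 0.
Proof.
move=> tphi.
have t2 := testfun_comp (@measurable_fst _ _ X unit) tphi.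
rewrite pint_comp_detr pint_comp_detl// pint_tens// pint_det; last first.
  exact: (testfun_sect1 x (testfun_pint_param _ t2)).
by rewrite pint_del//; exact: (testfun_sect2 x t2).
Qed.

Lemma pdomainE (f : pkernel X Y R) x :
  pdomain f x = if f x then det R (@measurable_id _ X setT) x else None.
Proof.
case: ifPn => fx.
  apply: pint_inj => phi tphi.
  by rewrite pint_pdomain// fx pint_det.
have := pint1 (pdomain f) x.
rewrite pint_pdomain// (negPf fx); case: (pk _ x) => // p /eqP.
by rewrite eq_sym onee_eq0.
Qed.

End domain.

Section pointwise.
Context d1 d2 d3 (X : measurableType d1) (Y : measurableType d2)
  (Z : measurableType d3).

Lemma pcomp_congr d0 (X' : measurableType d0) (g : pkernel Y Z R)
    (f : pkernel X Y R) (f' : pkernel X' Y R) x x' :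
  f x = f' x' -> pcomp g f x = pcomp g f' x'.
Proof. by rewrite /pcomp/= => ->. Qed.

Lemma pcomp_None (g : pkernel Y Z R) (f : pkernel X Y R) x :
  f x = None -> pcomp g f x = None.
Proof. by rewrite /pcomp/= => ->. Qed.

Lemma pcomp_Some (g : pkernel Y Z R) (f : pkernel X Y R) x p :
  f x = Some p -> pcomp g f x -> p (pdom g) = 1.
Proof. by rewrite /pcomp/= => ->; case: pselect. Qed.

(** The mass condition and the values of the composite at [x] are integrals
    against [p], so they do not change when [g] does on a [p]-null set. *)
Lemma pcomp_eq_on (g g' : pkernel Y Z R) (f : pkernel X Y R) x p (D : set Y) :
  f x = Some p -> measurable D -> p D = 1 ->
  (forall y, D y -> g y = g' y) -> pcomp g f x = pcomp g' f x.
Proof.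
move=> fx mD pD gg'.
have tD : testfun (fun y => (\1_D y)%:E : \bar R) by exact: testfun_indic.
have D1 y : (\1_D y)%:E <= 1 :> \bar R by exact: indic_le1.
have fD : pint f (fun y => (\1_D y)%:E) x = 1 by rewrite pint_indic// /peval fx.
have DP y : (\1_D y)%:E = 1 :> \bar R -> D y.
  rewrite indicE; case: (boolP (y \in D)) => [/set_mem//|_ [] /eqP].
  by rewrite eq_sym oner_eq0.
apply: pint_inj => phi tphi.
have eqg psi : testfun psi -> pint f (pint g psi) x = pint f (pint g' psi) x.
  move=> tpsi; apply: (pint_ae1 tD D1 fD); [exact: testfun_pint|exact: testfun_pint|].
  by move=> y /DP /gg' gy; rewrite /pint /pgiry gy.
by rewrite !pint_comp// !eqg.
Qed.

End pointwise.

Section pextends.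
Context d1 d2 (X : measurableType d1) (Y : measurableType d2).

Lemma kernel_extendsP (f g : pkernel X Y R) :
  pcomp f (pdomain g) = g <-> forall x, g x -> f x = g x.
Proof.
split=> [fg x gx|fg].
  rewrite -[in RHS]fg -[LHS](pcomp_detr (@measurable_id _ X setT)).
  by apply: pcomp_congr; rewrite pdomainE gx.
apply: pk_inj; apply/funext => x; case gx : (pk g x) => [p|].
  rewrite -gx -fg ?gx// -[RHS](pcomp_detr (@measurable_id _ X setT)).
  by apply: pcomp_congr; rewrite pdomainE gx.
by apply: pcomp_None; rewrite pdomainE gx.
Qed.

End pextends.

(** * Positivity *)

Section rectangles.
Context d1 d2 d3 (X : measurableType d1) (Y : measurableType d2)
  (Z : measurableType d3).

(** Rectangles generate the product sigma-algebra and are stable under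
    intersection. *)
Lemma peval_rect_inj (f g : X -> option (prob (Y * Z)%type R)) x :
  (forall A B, measurable A -> measurable B ->
    peval f x (A `*` B) = peval g x (A `*` B)) -> f x = g x.
Proof.
move=> fg; apply: peval_inj => S mS; move: fg; rewrite /peval.
case: (f x) (g x) => [p|] [q|]// pq.
- apply: (measure_unique [set A `*` B | A in measurable & B in measurable]
    (fun=> setT)) => //.
  + exact: measurable_prod_measurableType.
  + move=> _ _ [A1 mA1 [A2 mA2 <-]] [B1 mB1 [B2 mB2 <-]].
    exists (A1 `&` B1); first exact: measurableI.
    exists (A2 `&` B2); first exact: measurableI.
    by rewrite setXI.
  + by move=> _; exists setT => //; exists setT => //; rewrite setXTT.
  + by rewrite bigcup_const//; exists 0%N.
  + by move=> _ [A mA [B mB <-]]; exact: pq.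
  + move=> _; rewrite (_ : _ setT = 1) ?ltry//; exact: probability_setT.
- have := pq _ _ measurableT measurableT; rewrite setXTT [LHS]probability_setT.
  by move=> /eqP; rewrite onee_eq0.
- have := pq _ _ measurableT measurableT; rewrite setXTT [RHS]probability_setT.
  by move=> /esym/eqP; rewrite onee_eq0.
Qed.

(** Applied to [B `*` B], the equation says [b = b * b] for [b = k(B|x)]. *)
Lemma copyable_zero_one (k : pkernel X Z R) (B : set Z) x : measurable B ->
  pcomp (det R (@measurable_copy _ Z)) k =
    pcomp (ptens k k) (det R (@measurable_copy _ X)) ->
  peval k x B = 0 \/ peval k x B = 1.
Proof.
move=> mB kcopy; rewrite -pint_indic//; set b := pint k _ x.
have tB := testfun_indic R mB.
have tBB := testfun_indic R (measurableX mB mB).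
have : b = b * b.
  transitivity (pint (pcomp (det R (@measurable_copy _ Z)) k)
      (fun w => (\1_(B `*` B) w)%:E) x).
    rewrite pint_comp_detl//; apply: eq_pint => z.
    by rewrite !indicE in_setX/= andbb.
  rewrite kcopy pint_comp_detr pint_tens// -pintZl//; last exact: pint_ge0.
  apply: eq_pint => y; rewrite muleC -pintZl//.
  by apply: eq_pint => z; rewrite indic_setX.
have : b <= 1 by apply: pint_le1 => // z; exact: indic_le1.
have : 0 <= b by exact: pint_ge0.
case: b => // r; rewrite !lee_fin => r0 r1 [] rr.
have [->|rneq] := eqVneq r 0%R; first by left.
by right; congr _%:E; apply: (mulfI rneq); rewrite -rr mulr1.
Qed.

(** On a rectangle [A `*` B] the left side is the integral of [g(B|y)] over [A] and
    the right side is [f(A|x)] times the mean [b] of [g(B|y)], wherever [g f] is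
    defined. As [b] is [0] or [1], [g(B|y)] equals [b] for almost all [y]. *)
Lemma kernel_positive (f : pkernel X Y R) (g : pkernel Y Z R) :
  pcomp (det R (@measurable_copy _ Z)) (pcomp g f) =
    pcomp (ptens (pcomp g f) (pcomp g f)) (det R (@measurable_copy _ X)) ->
  pcomp (pcomp (ptens (det R (@measurable_id _ Y setT)) g)
    (det R (@measurable_copy _ Y))) f =
  pcomp (ptens f (pcomp g f)) (det R (@measurable_copy _ X)).
Proof.
set k := pcomp g f => kcopy.
apply: pk_inj; apply/funext => x; apply: peval_rect_inj => A B mA mB.
have mAB : measurable (A `*` B) by exact: measurableX.
rewrite -!pint_indic//.
pose phi (w : Y * Z) : \bar R := (\1_(A `*` B) w)%:E.
have tphi : testfun phi by exact: testfun_indic.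
have tA : testfun (fun z => (\1_A z)%:E : \bar R) by exact: testfun_indic.
have tB : testfun (fun z => (\1_B z)%:E : \bar R) by exact: testfun_indic.
have AB y z : phi (y, z) = (\1_A y)%:E * (\1_B z)%:E by exact: indic_setX.
have A0 y : 0 <= (\1_A y)%:E :> \bar R by rewrite lee_fin.
pose h := pint g (fun z => (\1_B z)%:E).
have th : testfun h by exact: testfun_pint.
have h1 y : h y <= 1 by apply: pint_le1 => // z; exact: indic_le1.
rewrite -/phi.
have Kint psi y : testfun psi ->
  pint (pcomp (ptens (det R (@measurable_id _ Y setT)) g)
    (det R (@measurable_copy _ Y))) psi y = pint g (fun z => psi (y, z)) y.
  move=> tpsi; rewrite pint_comp_detr pint_tens// pint_det//.
  exact: (testfun_sect1 y (testfun_pint_param g tpsi)).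
have -> : pint (pcomp (ptens f k) (det R (@measurable_copy _ X))) phi x =
    pint f (fun y => (\1_A y)%:E * pint k (fun z => (\1_B z)%:E) x) x.
  rewrite pint_comp_detr pint_tens//; apply: eq_pint => y.
  by rewrite -pintZl//; apply: eq_pint => z; rewrite AB.
have K1 : pint (pcomp (ptens (det R (@measurable_id _ Y setT)) g)
    (det R (@measurable_copy _ Y))) (fun=> 1) = pint g (fun=> 1).
  by apply/funext => y; rewrite Kint.
have Kphi : pint (pcomp (ptens (det R (@measurable_id _ Y setT)) g)
    (det R (@measurable_copy _ Y))) phi = fun y => (\1_A y)%:E * h y.
  apply/funext => y; rewrite Kint// -pintZl//.
  by apply: eq_pint => z; rewrite AB.
have tAh : testfun (fun y => (\1_A y)%:E * h y).
  by rewrite -Kphi; exact: testfun_pint.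
have f0 : pint f (fun=> 0) x = 0 by rewrite pint_cst// mul0e.
have Ab0 b : b = 0 -> pint f (fun y => (\1_A y)%:E * b) x = 0.
  by move=> ->; rewrite -[RHS]f0; apply: eq_pint => y; rewrite mule0.
have [fg|fg] := eqVneq (pint f (pint g (fun=> 1)) x) 1; last first.
  by rewrite pint_compF ?K1// Ab0// pint_compF.
rewrite pint_compT ?K1// Kphi.
have kh : pint k (fun z => (\1_B z)%:E) x = pint f h x by rewrite pint_compT.
have := copyable_zero_one x mB kcopy; rewrite -pint_indic// kh => -[hB|hB].
  rewrite Ab0//; apply/eqP; rewrite eq_le pint_ge0// andbT -[leRHS]hB.
  apply: le_pint => // y; rewrite indicE; case: (_ \in _); first by rewrite mul1e.
  by rewrite mul0e; exact: pint_ge0.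
rewrite hB.
transitivity (pint f (fun y => (\1_A y)%:E) x).
  apply: (pint_ae1 th h1 hB); [exact: tAh|exact: tA|move=> y ->].
  by rewrite mule1.
by apply: eq_pint => y; rewrite mule1.
Qed.

End rectangles.
End kernels.

(** * Meets of descending sequences *)

Section meets.
Context (R : realType).

Section pmeet.
Context d1 d2 (X : measurableType d1) (Y : measurableType d2).
Implicit Types (f : nat -> pkernel X Y R) (m g : pkernel X Y R).

Definition kdescending f := forall n x, f n.+1 x -> f n x = f n.+1 x.

Definition pointwise_meet f m :=
  forall x p, m x = Some p <-> forall n, f n x = Some p.

Lemma kdescending0 f : kdescending f -> forall n x, f n x -> f 0%N x = f n x.
Proof.
move=> fd; elim=> // n IHn x fx; rewrite -(fd _ _ fx); apply: IHn.
by rewrite fd.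
Qed.

Lemma kdescending_const f : kdescending f ->
  forall x, (forall n, f n x) -> forall n, f n x = f 0%N x.
Proof. by move=> fd x fx n; rewrite (kdescending0 fd (fx n)). Qed.

Section construction.
Variable f : nat -> pkernel X Y R.

(* The members of a descending sequence agree where they are all defined, so
   [f 0] gives their common value. *)
Let meet_fun (x : X) : option (prob Y R) :=
  if `[< forall n, f n x >] then f 0%N x else None.

Let meet_dom : pdom meet_fun = \bigcap_n pdom (f n).
Proof.
apply/seteqP; split=> x; rewrite /pdom /meet_fun /=; case: asboolP => //.
- by move=> fx _ n _; exact: fx.
- by move=> nfx fx; exfalso; apply: nfx => n; exact: (fx n I).
Qed.

Let measurable_meet_dom : measurable (pdom meet_fun).
Proof.
by rewrite meet_dom; apply: bigcap_measurable => // n _; exact: measurable_pdom.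
Qed.

Let measurable_meet S : measurable S ->
  measurable_fun (pdom meet_fun) (fun x => peval meet_fun x S).
Proof.
move=> mS; apply: (eq_measurable_fun (fun x => peval (f 0%N) x S)).
  by move=> x; rewrite inE /pdom /peval /meet_fun /=; case: asboolP.
by apply: (measurable_funS measurableT) => //; exact: measurable_pevalT.
Qed.

Definition pmeet : pkernel X Y R := PKernel measurable_meet_dom measurable_meet.

Lemma pmeetP : kdescending f -> pointwise_meet f pmeet.
Proof.
move=> fd x p; rewrite /= /meet_fun; case: asboolP => [fx|nfx].
  split=> [f0 n|->//]; by rewrite (kdescending_const fd).
by split=> // fx; exfalso; apply: nfx => n; rewrite fx.
Qed.

End construction.

Lemma pointwise_meet_lb f m : pointwise_meet f m ->
  forall n x, m x -> f n x = m x.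
Proof.
by move=> fm n x; case mx : (pk m x) => [p|//] _; have /fm -> := mx.
Qed.

Lemma pointwise_meet_glb f m g : pointwise_meet f m ->
  (forall n x, g x -> f n x = g x) -> forall x, g x -> m x = g x.
Proof.
move=> fm fg x; case gx : (pk g x) => [q|//] _.
by apply/fm => n; rewrite fg ?gx.
Qed.

End pmeet.

Section preservation.
Context d1 d2 (X : measurableType d1) (Y : measurableType d2).
Variables (f : nat -> pkernel X Y R) (m : pkernel X Y R).
Hypotheses (fd : kdescending f) (fm : pointwise_meet f m).

(** For an operation [F] on kernels whose value at [z] only depends on the value of
    its argument at [s z], and is undefined if that one is. *)
Lemma pointwise_meet_map d3 d4 (Z : measurableType d3) (W : measurableType d4)
    (F : pkernel X Y R -> pkernel Z W R) (s : Z -> X) :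
  (forall (g g' : pkernel X Y R) z, g (s z) = g' (s z) -> F g z = F g' z) ->
  (forall (g : pkernel X Y R) z, F g z -> g (s z)) ->
  pointwise_meet (fun n => F (f n)) (F m).
Proof.
move=> F_local F_strict z r; split=> [Fm n|Ff].
  rewrite -Fm; apply: F_local; apply: (pointwise_meet_lb fm).
  by apply: F_strict; rewrite Fm.
have fz n : f n (s z) by apply: F_strict; rewrite Ff.
rewrite -(Ff 0%N); apply: F_local.
case f0 : (pk (f 0%N) _) (fz 0%N) => [p|//] _.
by apply/fm => n; rewrite (kdescending_const fd).
Qed.

Lemma pointwise_meet_postcomp d3 (Z : measurableType d3) (h : pkernel Y Z R) :
  pointwise_meet (fun n => pcomp h (f n)) (pcomp h m).
Proof.
apply: (@pointwise_meet_map _ _ _ _ (pcomp h) id) => [g g' x|g x].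
  exact: pcomp_congr.
by case gx : (pk g x) => //; rewrite pcomp_None.
Qed.

Lemma pointwise_meet_tensl d3 d4 (A : measurableType d3) (B : measurableType d4)
    (g : pkernel A B R) :
  pointwise_meet (fun n => ptens (f n) g) (ptens m g).
Proof.
apply: (@pointwise_meet_map _ _ _ _ (fun k => ptens k g) fst) => [k k' z|k z].
  by rewrite /ptens/= => ->.
by rewrite /ptens/=; case: (pk k z.1).
Qed.

Lemma pointwise_meet_tensr d3 d4 (A : measurableType d3) (B : measurableType d4)
    (g : pkernel A B R) :
  pointwise_meet (fun n => ptens g (f n)) (ptens g m).
Proof.
apply: (@pointwise_meet_map _ _ _ _ (fun k => ptens g k) snd) => [k k' z|k z].
  by rewrite /ptens/= => ->.
by rewrite /ptens/=; case: (pk g z.1) => // p; case: (pk k z.2).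
Qed.

(** The value at [w] of a composite with [k] involves the values of [f n] at almost
    all points, so [k(.|w)] must give mass [1] to the intersection of the domains;
    there all [f n] agree with [m]. *)
Lemma pointwise_meet_precomp d3 (W : measurableType d3) (k : pkernel W X R) :
  pointwise_meet (fun n => pcomp (f n) k) (pcomp m k).
Proof.
move=> w r; case kw : (pk k w) => [p|]; last first.
  by rewrite pcomp_None//; split=> // /(_ 0%N); rewrite pcomp_None.
have eqm n (pm : p (pdom m) = 1) : pcomp (f n) k w = pcomp m k w.
  apply: (pcomp_eq_on kw (measurable_pdom m) pm) => x mx.
  exact: (pointwise_meet_lb fm).
split=> [mk n|fk].
  by rewrite eqm//; apply: (pcomp_Some kw); rewrite mk.
rewrite -(fk 0%N) eqm//.
have -> : pdom m = \bigcap_n pdom (f n).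
  apply/seteqP; split=> x; rewrite /pdom /=.
    by move=> mx n _ /=; rewrite (pointwise_meet_lb fm).
  move=> fx; have f0x : f 0%N x := fx 0%N I.
  case f0 : (pk (f 0%N) x) f0x => [q|//] _.
  have /fm -> // : forall n, f n x = Some q.
  by move=> n; rewrite (kdescending_const fd)// => i; exact: fx.
apply: probability_bigcap => n; first exact: measurable_pdom.
by apply: (pcomp_Some kw); rewrite fk.
Qed.

End preservation.
End meets.

(** * Composites through the empty space *)

Section empty.
Context d1 d2 d3 d4 (X : measurableType d1) (Y : measurableType d2)
  (Z : measurableType d3) (W : measurableType d4) (R : realType).

Lemma pcomp_pempty (g : pkernel Y Z R) : pcomp g (pempty X Y R) = pempty X Z R.
Proof. by apply: pk_inj; apply/funext => x; rewrite pcomp_None. Qed.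

Lemma pempty_pcomp (f : pkernel X Y R) : pcomp (pempty Y Z R) f = pempty X Z R.
Proof.
apply: pkernel_ext => phi x tphi; rewrite pint_compF//.
  by rewrite [RHS]pint_None.
have -> : pint (pempty Y Z R) (fun=> 1) = fun=> 0.
  by apply/funext => y; rewrite pint_None.
by rewrite pint_cst// mul0e eq_sym onee_eq0.
Qed.

Lemma ptens_pemptyl (g : pkernel Z W R) :
  ptens (pempty X Y R) g = pempty (X * Z)%type (Y * W)%type R.
Proof. exact: pk_inj. Qed.

Lemma ptens_pemptyr (f : pkernel X Y R) :
  ptens f (pempty Z W R) = pempty (X * Z)%type (Y * W)%type R.
Proof.
apply: pk_inj; apply/funext => x; rewrite /ptens/=.
by case: (pk f x.1).
Qed.

End empty.

(** * The category of partial kernels between standard Borel spaces *)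

Section category.
Context (R : realType).
Local Open Scope qm_scope.
Local Notation C := (partialBorelStoch R).

Lemma pbs_category : is_category C.
Proof.
split.
- by move=> [|X] [|Y] // f; [case: f|case: f|case: f|exact: pcomp_idl].
- by move=> [|X] [|Y] // f; [case: f|case: f|case: f|exact: pcomp_idr].
- move=> [|X] [|Y] [|Z] [|W] //= h g f.
  + by rewrite pcomp_pempty.
  + by rewrite pempty_pcomp.
  + exact: pcompA.
Qed.

Lemma pbs_symmetric_monoidal : is_symmetric_monoidal C.
Proof.
split.
- by move=> [|X] [|Y]//=; rewrite det_tens; apply: eq_det; case.
- move=> [|X] [|Y] [|Z] [|X'] [|Y'] [|Z'] //= g f g' f'.
  + by rewrite ptens_pemptyl.
  + by rewrite ptens_pemptyl.
  + by rewrite ptens_pemptyr.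
  + exact: ptens_comp.
- move=> [|X] [|Y] [|Z] //=; rewrite det_comp.
  by apply: eq_det => -[[]].
- move=> [|X] [|Y] [|Z] //=; rewrite det_comp.
  by apply: eq_det => -[? []].
- move=> [|X] //=; rewrite det_comp.
  by apply: eq_det => -[[]].
- move=> [|X] //=; rewrite det_comp.
  exact: eq_det.
- move=> [|X] //=; rewrite det_comp.
  by apply: eq_det => -[? []].
- move=> [|X] //=; rewrite det_comp.
  exact: eq_det.
- move=> [|X] [|Y] //=; rewrite det_comp.
  by apply: eq_det => -[].
- move=> [|X] [|Y] [|Z] [|X'] [|Y'] [|Z'] //= f g h.
  exact: ptens_assoc_nat.
- move=> [|X] [|Y] // f; exact: ptens_lunit_nat.
- move=> [|X] [|Y] // f; exact: ptens_runit_nat.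
- move=> [|X] [|Y] [|X'] [|Y'] //= f g.
  exact: ptens_swap_nat.
- move=> [|X] [|Y] [|Z] [|W] //=; rewrite !(det_comp, det_tens).
  by apply: eq_det=> -[[]].
- move=> [|X] [|Y] //=; rewrite !(det_comp, det_tens).
  by apply: eq_det=> -[[]].
- move=> [|X] [|Y] [|Z] //=; rewrite !(det_comp, det_tens).
  by apply: eq_det=> -[[]].
Qed.

Lemma pbs_comonoids : has_comonoids C.
Proof.
split.
- by move=> [|X] //=; rewrite !(det_comp, det_tens); exact: eq_det.
- by move=> [|X] //=; rewrite !(det_comp, det_tens); exact: eq_det.
- by move=> [|X] //=; rewrite !(det_comp, det_tens); exact: eq_det.
- by move=> [|X] //=; rewrite !(det_comp, det_tens); exact: eq_det.
- by move=> [|X] [|Y] //=; rewrite !(det_comp, det_tens); apply: eq_det => -[].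
- by move=> [|X] [|Y] //=; rewrite !(det_comp, det_tens); apply: eq_det => -[].
- by apply: eq_det; case.
- by apply: eq_det; case.
Qed.

Lemma pbs_quasi_markov_law : quasi_markov_law C.
Proof. by move=> [|X] [|Y] f; [case: f|case: f|case: f|exact: kernel_quasi_markov]. Qed.

Lemma pbs_positive : positive C.
Proof. by move=> [|X] [|Y] [|Z] //= f g; exact: kernel_positive. Qed.

Lemma extends_kernelP (X Y : inhabitedBorel R) (f g : pkernel X Y R) :
  @extends C (Space X) (Space Y) f g <-> forall x, g x -> f x = g x.
Proof. exact: kernel_extendsP. Qed.

Lemma pointwise_meet_is_meet (X Y : inhabitedBorel R) (f : nat -> pkernel X Y R)
    (m : pkernel X Y R) : pointwise_meet f m ->
  @is_meet C (Space X) (Space Y) f m.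
Proof.
move=> fm; split=> [n|g fg].
  by apply/extends_kernelP; exact: pointwise_meet_lb.
apply/extends_kernelP; apply: (pointwise_meet_glb fm) => n.
exact/extends_kernelP.
Qed.

Lemma descending_kernelP (X Y : inhabitedBorel R) (f : nat -> pkernel X Y R) :
  @descending C (Space X) (Space Y) f <-> kdescending f.
Proof. by split=> fd n; apply/extends_kernelP; exact: fd. Qed.

(** Meets are unique, so any meet is the one constructed in [pmeet]. *)
Lemma is_meet_pointwise_meet (X Y : inhabitedBorel R) (f : nat -> pkernel X Y R)
    (m : pkernel X Y R) : kdescending f ->
  @is_meet C (Space X) (Space Y) f m -> pointwise_meet f m.
Proof.
move=> fd [lb glb].
have [lb' glb'] := pointwise_meet_is_meet (pmeetP fd).
suff -> : m = pmeet f by exact: pmeetP.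
have /extends_kernelP mM := glb _ lb'; have /extends_kernelP Mm := glb' _ lb.
apply: pk_inj; apply/funext => x.
case Mx : (pk (pmeet f) x) => [p|]; first by rewrite mM Mx.
by case mx : (pk m x) => [p|//]; rewrite -Mx -mx Mm// mx.
Qed.

(** Applies to the hom-sets from or to the empty space. *)
Lemma is_meet_subsingleton (X Y : obj C) (f : nat -> hom X Y) (m : hom X Y) :
  (forall g h : hom X Y, g = h) -> is_meet f m.
Proof. by move=> eqh; split=> [n|g _]; exact: eqh. Qed.

(** A sequence of composites through the empty space is constantly [pempty]. *)
Lemma is_meet_pempty (X Y : inhabitedBorel R) :
  @is_meet C (Space X) (Space Y) (fun=> pempty X Y R) (pempty X Y R).
Proof. by apply: pointwise_meet_is_meet => x p; split=> // /(_ 0%N). Qed.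

Lemma pbs_descending_meets : has_descending_meets C.
Proof.
move=> [|X] [|Y] f fd; try by exists tt; apply: is_meet_subsingleton => -[] [].
by exists (pmeet f); apply/pointwise_meet_is_meet/pmeetP/descending_kernelP.
Qed.

Lemma pbs_preserves_descending_meets : preserves_descending_meets C.
Proof.
move=> [|X] [|Y] f m fd fm.
- split.
  + by move=> [|Z] h; apply: is_meet_subsingleton => -[] [].
  + by move=> [|W] k; apply: is_meet_subsingleton => -[] [].
  + by move=> [|A] [|B] g; apply: is_meet_subsingleton => -[] [].
  + by move=> [|A] [|B] g; apply: is_meet_subsingleton => -[] [].
- split.
  + by move=> [|Z] h; apply: is_meet_subsingleton => -[] [].
  + move=> [|W] k; first by apply: is_meet_subsingleton => -[] [].
    exact: is_meet_pempty.
  + by move=> [|A] [|B] g; apply: is_meet_subsingleton => -[] [].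
  + by move=> [|A] [|B] g; apply: is_meet_subsingleton => -[] [].
- split.
  + move=> [|Z] h; first by apply: is_meet_subsingleton => -[] [].
    exact: is_meet_pempty.
  + by move=> [|W] k; apply: is_meet_subsingleton => -[] [].
  + by move=> [|A] [|B] g; apply: is_meet_subsingleton => -[] [].
  + by move=> [|A] [|B] g; apply: is_meet_subsingleton => -[] [].
have {}fd : kdescending f by exact/descending_kernelP.
have {}fm : pointwise_meet f m by exact: is_meet_pointwise_meet.
split.
- move=> [|Z] h; first by apply: is_meet_subsingleton => -[] [].
  by apply: pointwise_meet_is_meet; exact: pointwise_meet_postcomp.
- move=> [|W] k; first by apply: is_meet_subsingleton => -[] [].
  by apply: pointwise_meet_is_meet; exact: pointwise_meet_precomp.
- move=> [|A] [|B] g; try by apply: is_meet_subsingleton => -[] [].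
  by apply: pointwise_meet_is_meet; exact: pointwise_meet_tensl.
- move=> [|A] [|B] g; try by apply: is_meet_subsingleton => -[] [].
  by apply: pointwise_meet_is_meet; exact: pointwise_meet_tensr.
Qed.

End category.

Theorem proposition2p31 (R : realType) :
  [/\ quasi_markov (partialBorelStoch R), positive (partialBorelStoch R)
    & sigma_continuous (partialBorelStoch R)].
Proof.
split.
- split; [exact: pbs_category|exact: pbs_symmetric_monoidal
         |exact: pbs_comonoids|exact: pbs_quasi_markov_law].
- exact: pbs_positive.
- by split; [exact: pbs_descending_meets|exact: pbs_preserves_descending_meets].
Qed.
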